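(* Let $\|\cdot\|=\|\cdot\|_p$ on $\mathbb R^d$ with $1\le p\le2$, let $f:\mathcal X\to\mathbb R$, $f(x)=\mathbb E_{Z\sim\pi}[F(x,Z)]$, $f^*=\min_{x\in\mathcal X}f(x)$, and assume: (i) $f$ is differentiable and $L$-smooth on $\mathcal X$ for some $L>0$: $\|\nabla f(x)-\nabla f(y)\|_*\le L\|x-y\|$ for all $x,y\in\mathcal X$; (ii) $f$ is convex on $\mathcal X$: $f(y)\le f(x)-\langle\nabla f(y),x-y\rangle$ for all $x,y\in\mathcal X$; (iii) $\{Z_t\}_{t\ge0}$ is a stationary Markov chain on $\mathsf Z$ with unique invariant distribution $\pi$, uniformly geometrically ergodic with mixing time $\tau_{\text{mix}}$: $|\mathbb P\{Z_t=z\mid Z_0=z_0\}-\pi_z|\lesssim(1/2)^{t/\tau_{\text{mix}}}$ for all $t>0$ and $z_0,z\in\mathsf Z$; (iv) for all $x\in\mathbb R^d$, $\mathbb E_\pi[\nabla F(x,Z)]=\nabla f(x)$, and $\|\nabla F(x,Z)-\nabla f(x)\|_*^2\le\sigma^2$ for all $Z\in\mathsf Z$ and $x\in\mathbb R^d$. Let $\{x^t,x_g^t,x_f^t\}$ be generated by the batched Markovian Accelerated Mirror Descent method (described in the context) with positive stepsizes $\{\gamma_t\}$, momentums $\{\beta_t\}$, batch size $B$ and batch size limit $M$. Assume $0\le(\beta_{t+1}-1)\gamma_{t+1}\le\beta_t\gamma_t$ and $\beta_t\ge2\gamma_tL$ for all $t\ge0$, and $\beta_0=1$. Then for all $T\ge0$,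 $$(\beta_T-1)\gamma_T\,\mathbb E[f(x_f^T)-f^*]=\widetilde{\mathcal O}\Big(D^2+\tau_{\text{mix}}B^{-1}\big(TM^{-1}+\log M\big)\sigma^2\sum_{t=0}^{T-1}\gamma_t^2\Big).$$
   Context: Geometry. $\mathcal X\subset\mathbb R^d$ is a nonempty compact convex set; $\|y\|_*=\max_{\|z\|\le1}\langle y,z\rangle$ is the conjugate norm. $\omega$ is a proper convex lower semicontinuous function, $1$-strongly convex with respect to $\|\cdot\|$ on $\mathcal X$; the Bregman divergence is $V(x,y)=\omega(y)-\omega(x)-\langle\omega'(x),y-x\rangle$ with $\omega'(x)\in\partial\omega(x)$; it is assumed to exist on $\mathcal X$. $D^2:=\max_{x,y\in\mathcal X}V(x,y)$. Prox mapping: $P_x(\xi):=\arg\min_{y\in\mathcal X}\{V(x,y)+\langle\xi,y\rangle\}$. Noise. $\mathsf Z$ is the state space of the chain; $\pi_z$ is the mass of $\pi$ at $z$. $\tau_{\text{mix}}\in\mathbb N$. Batched Markovian Accelerated Mirror Descent. Start from $x^0=x_f^0\in\mathcal X$, $N_0=0$. For $t=0,1,2,\dots$: set $x_g^t=\beta_t^{-1}x^t+(1-\beta_t^{-1})x_f^t$; sample $J_t\sim\mathrm{Geom}(1/2)$ independently (so $\mathbb P\{J_t=i\}=2^{-i}$, $i\ge1$); with $g_j^t=2^{-j}B^{-1}\sum_{i=1}^{2^jB}\nabla F(x_g^t,Z_{N_t+i})$ set $g^t=g_0^t+2^{J_t}(g^t_{J_t}-g^t_{J_t-1})$ if $2^{J_t}\le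 M$ and $g^t=g_0^t$ otherwise; then $x^{t+1}=P_{x^t}(\gamma_tg^t)$, $N_{t+1}=N_t+2^{J_t}B$, $x_f^{t+1}=\beta_t^{-1}x^{t+1}+(1-\beta_t^{-1})x_f^t$. Here $B\ge1$ and $M\ge2$ are integers. Asymptotic notation. $a\lesssim b$ means $a\le Cb$ for a constant $C>0$. $a(T)=\widetilde{\mathcal O}(b(T))$ means there is $C>0$ with $a(T)\le C\log(T)\,b(T)$ for all $T\ge2$; $C$ does not depend on $T,D,L,\sigma,\tau_{\text{mix}},\{\gamma_t\},\{\beta_t\},B,M$ (it may depend on $\pi$, on the constant hidden in (iii), and on the dimension $d$ through a factor of order $\log d$, which the paper omits).
   Formalization: The subgradient ω'(x) is also required to be the one-sided directional derivative of ω at x in directions y−x, y∈X (true if ω is differentiable or ω' is continuous on X); for arbitrary subgradients at kinks the claim is false. The state space is taken countable. *)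

(* Defs.v *)
From HB Require Import structures.
From mathcomp Require Export all_boot all_order all_algebra.
From mathcomp Require Export all_classical all_reals all_analysis.

Set Implicit Arguments.
Unset Strict Implicit.
Unset Printing Implicit Defensive.

Export Order.TTheory GRing.Theory Num.Theory.
Export numFieldNormedType.Exports.

Local Open Scope classical_set_scope.
Local Open Scope ring_scope.

Section Geometry.
Context {R : realType} {d : nat}.
Local Notation vec := 'rV[R]_d.
Implicit Types (x y v : vec) (X : set vec).

Definition dot x y : R := \sum_(i < d) x 0 i * y 0 i.

Definition pnorm (p : R) x : R := (\sum_(i < d) `|x 0 i| `^ p) `^ p^-1.

(* The supremum is a maximum: the unit ball of the p-norm is compact. *)
Definition dual_norm (nrm : vec -> R) y : R :=
  sup [set dot y z | z in [set z | nrm z <= 1]].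

Definition is_min_on (T : Type) (A : set T) (h : T -> R) (m : R) :=
  (exists2 a, A a & h a = m) /\ forall a, A a -> m <= h a.

Definition is_max_on (T : Type) (A : set T) (h : T -> R) (m : R) :=
  (exists2 a, A a & h a = m) /\ forall a, A a -> h a <= m.

Definition proper_fun (omega : vec -> \bar R) :=
  (exists x, omega x != +oo%E) /\ forall x, omega x != -oo%E.

Definition econvex (omega : vec -> \bar R) :=
  forall x y (t : R), 0 < t < 1 ->
    (omega (t *: x + (1 - t) *: y)%R
     <= t%:E * omega x + (1 - t)%:E * omega y)%E.

Definition strongly_convex1 (nrm : vec -> R) X (omega : vec -> \bar R) :=
  forall x y (t : R), X x -> X y -> 0 < t < 1 ->
    (omega (t *: x + (1 - t) *: y)%R
     <= t%:E * omega x + (1 - t)%:E * omega y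
        - (2^-1 * t * (1 - t) * nrm (x - y) ^+ 2)%:E)%E.

Definition subgradient (omega : vec -> \bar R) x v :=
  omega x \is a fin_num /\
  forall y, (omega x + (dot v (y - x)%R)%:E <= omega y)%E.

(* [domega x] is a subgradient of [omega] at [x] and, as the notation omega'(x)
   says, the derivative of [omega] at [x] in the directions that point into [X].
   The second clause holds when [omega] is differentiable on [X], and for every
   selection of subgradients that is continuous on [X].  An arbitrary selection
   at a kink of [omega] will not do: for omega(u) = u^2/2 + |u| on [-1, 1] and
   omega'(0) = 0, mirror steps with small gradients never leave 0. *)
Definition distance_gradient X (omega : vec -> \bar R) (domega : vec -> vec) :=
  (forall x, X x -> subgradient omega x (domega x)) /\
  forall x y, X x -> X y ->
    (fun h : R => h^-1 * (fine (omega (x + h *: (y - x))) - fine (omega x)))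
      @ 0^'+ --> dot (domega x) (y - x).

Definition bregman (omega : vec -> \bar R) (domega : vec -> vec) x y : R :=
  fine (omega y) - fine (omega x) - dot (domega x) (y - x).

(* [y] is the value of the prox mapping P_x(xi). *)
Definition is_prox X (V : vec -> vec -> R) x xi y :=
  X y /\ forall u, X u -> V x y + dot xi y <= V x u + dot xi u.

(* Only the values of [f] on [X] matter, so this is differentiability of the
   restriction of [f] to [X], with [gradf x] as gradient at [x]. *)
Definition has_gradient_on X (f : vec -> R) (gradf : vec -> vec) :=
  forall x, X x -> forall e : R, 0 < e ->
    \forall y \near within X (nbhs x),
      `|f y - f x - dot (gradf x) (y - x)| <= e * `|y - x|.

End Geometry.

Section Noise.
Context {R : realType} {dZ : measure_display} {Z : measurableType dZ}.
Local Open Scope ereal_scope.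

Definition has_mean (pi : probability Z R) (g : Z -> R) (m : R) :=
  pi.-integrable setT (EFin \o g) /\ 'E_pi[g] = m%:E.

Definition has_vmean (d : nat) (pi : probability Z R)
    (g : Z -> 'rV[R]_d) (m : 'rV[R]_d) :=
  forall i, has_mean pi (fun z => g z ord0 i) (m ord0 i).

Definition invariant_law (K : R.-pker Z ~> Z) (mu : probability Z R) :=
  forall A, measurable A -> \int[mu]_z K z A = mu A.

Definition unique_invariant_law (K : R.-pker Z ~> Z) (pi : probability Z R) :=
  invariant_law K pi /\
  forall mu : probability Z R, invariant_law K mu ->
    forall A, measurable A -> mu A = pi A.

Fixpoint kernel_iter (K : R.-pker Z ~> Z) (t : nat) (z : Z) (A : set Z)
    : \bar R :=
  if t is t'.+1 then \int[K z]_y kernel_iter K t' y A else \d_z A.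

(* The conditional probability of {Z_t = z} given Z_0 = z0 is the mass at z of
   the t-step kernel started at z0, which is meaningful for every z0. *)
Definition geometrically_ergodic (K : R.-pker Z ~> Z) (pi : probability Z R)
    (C0 : R) (tau : nat) :=
  forall t (z0 z : Z), (0 < t)%N ->
    (`| fine (kernel_iter K t z0 [set z]) - fine (pi [set z]) |
     <= C0 * 2^-1 `^ (t%:R / tau%:R))%R.

Context {dO : measure_display} {Om : measurableType dO}.
Variable P : probability Om R.

Definition path_event (T : Type) (Y : nat -> Om -> T) (n : nat) (y : nat -> T)
    : set Om :=
  [set w | forall i, (i < n)%N -> Y i w = y i].

(* On a countable state space these point masses of the finite-dimensional laws
   determine the law of the chain. *)
Definition stationary_markov_chain (K : R.-pker Z ~> Z) (pi : probability Z R)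
    (Zt : nat -> {RV P >-> Z}) :=
  (forall A, measurable A -> P (Zt 0%N @^-1` A) = pi A) /\
  forall n (z : nat -> Z),
    P (path_event Zt n.+2 z) = P (path_event Zt n.+1 z) * K (z n) [set z n.+1].

(* Mutual independence of the whole chain, J_0, J_1, ... *)
Definition independent_geometric (Zt : nat -> {RV P >-> Z})
    (J : nat -> {RV P >-> nat}) :=
  (forall t i, (0 < i)%N -> P [set w | J t w = i] = (2^-1 ^+ i)%:E) /\
  forall n m (z : nat -> Z) (j : nat -> nat),
    P (path_event Zt n z `&` path_event J m j) =
    P (path_event Zt n z) * \prod_(0 <= t < m) P [set w | J t w = j t].

End Noise.

Section Algorithm.
Context {R : realType} {d : nat} {Z Om : Type}.
Local Notation vec := 'rV[R]_d.

Definition batch_mean (G : Z -> vec) (z : nat -> Z) (N m : nat) : vec :=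
  m%:R^-1 *: \sum_(1 <= i < m.+1) G (z (N + i)%N).

Definition mlmc_gradient (G : Z -> vec) (z : nat -> Z) (N B M j : nat) : vec :=
  let g i := batch_mean G z N (2 ^ i * B) in
  if (2 ^ j <= M)%N then g 0%N + 2 ^+ j *: (g j - g j.-1) else g 0%N.

(* The iterates are functions of the sample point [w : Om]. *)
Record batched_mamd (X : set vec) (V : vec -> vec -> R)
    (gradF : vec -> Z -> vec) (Zt : nat -> Om -> Z) (J : nat -> Om -> nat)
    (gamma beta : nat -> R) (B M : nat)
    (x xg xf : nat -> Om -> vec) (N : nat -> Om -> nat) : Prop := {
  mamd_init : exists2 x0, X x0 & forall w, x 0%N w = x0 /\ xf 0%N w = x0 ;
  mamd_N0 : forall w, N 0%N w = 0%N ;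
  mamd_xg : forall t w,
    xg t w = (beta t)^-1 *: x t w + (1 - (beta t)^-1) *: xf t w ;
  mamd_x : forall t w,
    is_prox X V (x t w)
      (gamma t *: mlmc_gradient (gradF (xg t w)) (Zt ^~ w) (N t w) B M (J t w))
      (x t.+1 w) ;
  mamd_N : forall t w, N t.+1 w = (N t w + 2 ^ J t w * B)%N ;
  mamd_xf : forall t w,
    xf t.+1 w = (beta t)^-1 *: x t.+1 w + (1 - (beta t)^-1) *: xf t w
}.

End Algorithm.

(* Main.v *)
Require Import Defs.
From mathcomp Require Import ring lra zify.

Set Implicit Arguments.
Unset Strict Implicit.
Unset Printing Implicit Defensive.

Local Open Scope classical_set_scope.
Local Open Scope ring_scope.

(** The weighted gap of accelerated mirror descent telescopes along each
    trajectory ([accelerated_regret]). Compared with exact gradients, step [t]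
    with gradient error [e] costs
      - gamma dot e (x_t - u) + 1/4 Phi (- 4 gamma e),
    where [Phi = bconj X omega domega x_t] is the convex conjugate of the Bregman
    divergence based at [x_t]. It remains to bound the expectation of this cost
    when the gradients are read from a Markov chain.

    Working with [Phi] rather than with the squared dual norm is what makes the
    variance estimate elementary. Since [omega] is 1-strongly convex, [Phi] is
    1-smooth for the dual norm ([bconj_smooth]): adding an increment changes it by
    a linear term and half the squared size of the increment. For martingale
    increments the linear term has mean zero, so [Phi] of a sum of [r] increments
    of size [a] has expectation at most [r a^2 / 2], as in a Hilbert space, with
    no constant depending on the dimension or on [p].

    The chain supplies martingales as follows. Ergodicity is only assumed for point
    masses, but a finite set carries most of the invariant law, and so after
    [b = c tau] steps, with [c] depending on that law and on [C0] only, the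
    transition operator contracts centred functions by a factor 4
    ([mixing_blocks]). Along times spaced by [b], the Doob martingale of a sum of
    centred fields of size [s] therefore has increments of order [s]
    ([conj_path_sum_le]). A batch of size [N] is an average of [b] such sums, one
    per residue modulo [b], and convexity of [Phi] gives a variance of order
    [s^2 b / N] ([conj_batch_mean_le]).

    In the multilevel estimator, level [l] is drawn with probability [2^-l] and
    carries the weight [2^l]. In mean the levels telescope, and only the bias of
    the largest batch, of size about [M B], remains ([integral_dot_mlmc]). In
    variance each level contributes the same amount [s^2 b / B], so the total is
    [log M] times that ([conj_mlmc_le]). The bias is paired with [x_t - u], whose
    norm is bounded by the diameter, and the arithmetic-geometric inequality
    yields the terms [D^2] and [T / M].

    All conditional expectations are taken on the countably many histories of the
    states and levels; the iterates are constant on them ([iterates_adapted]), and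
    inequalities between integrals are glued with [le_integral_fibers]. *)

(** * The pairing and the dual norm *)

Section Pairing.
Context {R : realType} {d : nat}.
Local Notation vec := 'rV[R]_d.
Implicit Types (x y v : vec) (a b : R).

Lemma dotDl x y v : dot (x + y) v = dot x v + dot y v.
Proof.
by rewrite -big_split; apply: eq_bigr => i _; rewrite mxE mulrDl.
Qed.

Lemma dotDr v x y : dot v (x + y) = dot v x + dot v y.
Proof.
by rewrite -big_split; apply: eq_bigr => i _; rewrite mxE mulrDr.
Qed.

Lemma dotZl a x v : dot (a *: x) v = a * dot x v.
Proof. by rewrite mulr_sumr; apply: eq_bigr => i _; rewrite mxE mulrA. Qed.

Lemma dotZr a v x : dot v (a *: x) = a * dot v x.
Proof. by rewrite mulr_sumr; apply: eq_bigr => i _; rewrite mxE mulrCA. Qed.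

Lemma dotNl x v : dot (- x) v = - dot x v.
Proof. by rewrite -scaleN1r dotZl mulN1r. Qed.

Lemma dotNr v x : dot v (- x) = - dot v x.
Proof. by rewrite -scaleN1r dotZr mulN1r. Qed.

Lemma dotBl x y v : dot (x - y) v = dot x v - dot y v.
Proof. by rewrite dotDl dotNl. Qed.

Lemma dotBr v x y : dot v (x - y) = dot v x - dot v y.
Proof. by rewrite dotDr dotNr. Qed.

Lemma dot0l v : dot 0 v = 0.
Proof. by rewrite -(scale0r 0) dotZl mul0r. Qed.

Lemma dot0r v : dot v 0 = 0.
Proof. by rewrite -(scale0r 0) dotZr mul0r. Qed.

Lemma dot_suml (I : Type) (r : seq I) (Q : pred I) (F : I -> vec) v :
  dot (\sum_(i <- r | Q i) F i) v = \sum_(i <- r | Q i) dot (F i) v.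
Proof.
by apply: (big_morph (dot ^~ v)) => [x y|]; rewrite ?dotDl ?dot0l.
Qed.

End Pairing.

Section DualBound.
Context {R : realType} {d : nat} {p : R}.
Hypothesis p_ge1 : 1 <= p.
Local Notation vec := 'rV[R]_d.
Local Notation nrm := (@pnorm R d p).
Implicit Types (x y v : vec) (a b : R).

Let p_gt0 : 0 < p. Proof. exact: lt_le_trans p_ge1. Qed.
Let p_neq0 : p != 0. Proof. by rewrite gt_eqF. Qed.

Lemma pnorm_ge0 x : 0 <= nrm x.
Proof. exact: powR_ge0. Qed.

Lemma pnormZ a x : nrm (a *: x) = `|a| * nrm x.
Proof.
rewrite /pnorm.
under eq_bigr do rewrite mxE normrM powRM //.
rewrite -mulr_sumr powRM ?powR_ge0//; last first.
  by apply: sumr_ge0 => i _; exact: powR_ge0.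
by rewrite -powRrM mulfV// powRr1.
Qed.

Lemma pnormN x : nrm (- x) = nrm x.
Proof. by rewrite -scaleN1r pnormZ normrN1 mul1r. Qed.

Lemma le_coord_pnorm x i : `|x 0 i| <= nrm x.
Proof.
have -> : `|x 0 i| = (`|x 0 i| `^ p) `^ p^-1.
  by rewrite -powRrM mulfV// powRr1.
apply: ge0_ler_powR; rewrite ?nnegrE ?invr_ge0 ?powR_ge0 ?(ltW p_gt0)//.
  by apply: sumr_ge0 => j _; exact: powR_ge0.
by rewrite (bigD1 i)//= lerDl sumr_ge0// => j _; exact: powR_ge0.
Qed.

Lemma pnorm_eq0 x : nrm x = 0 -> x = 0.
Proof.
move=> x0; apply/rowP => i; rewrite mxE; apply/eqP.
by rewrite -normr_le0 -x0 le_coord_pnorm.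
Qed.

(** A bound on the dual norm of [y], as a family of inequalities that are linear
    in [y] and therefore pass through sums and integrals. *)
Definition dbound a y := forall v, `|dot y v| <= a * nrm v.

Lemma dual_norm_bound y : dbound (dual_norm nrm y) y.
Proof.
have ubd : has_ubound [set dot y z | z in [set z | nrm z <= 1]].
  exists (\sum_i `|y 0 i|) => _ [z /= z1 <-].
  apply: (le_trans (ler_norm _)); apply: (le_trans (ler_norm_sum _ _ _)).
  apply: ler_sum => i _; rewrite normrM ler_piMr//.
  by rewrite (le_trans (le_coord_pnorm _ _)).
have key v : dot y v <= dual_norm nrm y * nrm v.
  have [v0|v_neq0] := eqVneq (nrm v) 0.
    by rewrite v0 mulr0 (pnorm_eq0 v0) dot0r.
  have v_gt0 : 0 < nrm v by rewrite lt_neqAle eq_sym v_neq0 pnorm_ge0.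
  rewrite -ler_pdivrMr// mulrC -dotZr.
  apply: ub_le_sup => //; exists ((nrm v)^-1 *: v) => //=.
  by rewrite pnormZ gtr0_norm ?invr_gt0// mulVf.
by move=> v; rewrite ler_norml -lerN2 opprK -dotNr -{1}(pnormN v) !key.
Qed.

Lemma dboundW a b y : a <= b -> dbound a y -> dbound b y.
Proof. by move=> ab ya v; rewrite (le_trans (ya v))// ler_wpM2r ?pnorm_ge0. Qed.

Lemma dbound0 : dbound 0 0.
Proof. by move=> v; rewrite dot0l normr0 mul0r. Qed.

Lemma dboundD a b x y : dbound a x -> dbound b y -> dbound (a + b) (x + y).
Proof.
by move=> xa yb v; rewrite dotDl mulrDl (le_trans (ler_normD _ _))// lerD.
Qed.

Lemma dboundZ c a x : dbound a x -> dbound (`|c| * a) (c *: x).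
Proof. by move=> xa v; rewrite dotZl normrM -mulrA ler_wpM2l. Qed.

Lemma dboundN a x : dbound a x -> dbound a (- x).
Proof. by move=> xa v; rewrite dotNl normrN. Qed.

Lemma dbound_sum (I : Type) (r : seq I) (Q : pred I) (c : I -> R) F :
  (forall i, Q i -> dbound (c i) (F i)) ->
  dbound (\sum_(i <- r | Q i) c i) (\sum_(i <- r | Q i) F i).
Proof.
move=> Fc; elim/big_ind2 : _ => [||//]; first exact: dbound0.
by move=> *; exact: dboundD.
Qed.

End DualBound.
Arguments dbound {R d} p a y.

(** * The Bregman divergence and its conjugate *)

Lemma convex_set_comb (R : realType) (d : nat) (X : set 'rV[R]_d) x y (t : R) :
  convex_set X -> X x -> X y -> 0 <= t <= 1 -> X (t *: x + (1 - t) *: y).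
Proof.
move=> cX Xx Xy /andP[t0 t1].
by have /set_mem := cX x y (Itv01 t0 t1) (mem_set Xx) (mem_set Xy).
Qed.

Lemma continuous_dot (R : realType) (d : nat) (c : 'rV[R]_d) :
  continuous (dot c).
Proof.
apply: (@continuous_big R^o) => [|i _ y]; first exact: add_continuous.
apply: (@cvgM R _ (nbhs y) _ (fun=> c 0 i)); first exact: cvg_cst.
exact: coord_continuous.
Qed.

Section Bregman.
Context {R : realType} {d : nat} {p : R}.
Hypothesis p_ge1 : 1 <= p.
Local Notation vec := 'rV[R]_d.
Local Notation nrm := (@pnorm R d p).
Context {X : set vec} {omega : vec -> \bar R} {domega : vec -> vec}.
Hypothesis X_compact : compact X.
Hypothesis X_convex : convex_set X.
Hypothesis omega_sc : strongly_convex1 nrm X omega.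
Hypothesis omega_dg : distance_gradient X omega domega.
Implicit Types (x y u v xi : vec).
Local Notation w y := (fine (omega y)).
Local Notation V := (bregman omega domega).

Let omega_fin x : X x -> omega x \is a fin_num.
Proof. by move=> /omega_dg.1[]. Qed.

Let omega_sub x y : X x -> X y -> w x + dot (domega x) (y - x) <= w y.
Proof.
move=> Xx Xy; have := (omega_dg.1 x Xx).2 y.
by rewrite -(fineK (omega_fin Xx)) -(fineK (omega_fin Xy)) -EFinD lee_fin.
Qed.

(** Strong convexity on the segment from [x] to [y] gives the bound with the
    factor [1 - h] at the point of parameter [h]; then [h] tends to 0. *)
Lemma bregman_ge x y : X x -> X y -> 2^-1 * nrm (y - x) ^+ 2 <= V x y.
Proof.
move=> Xx Xy.
set q := nrm (y - x) ^+ 2; set s := dot (domega x) (y - x).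
have key (h : R) : 0 < h < 1 -> s <= w y - w x - 2^-1 * (1 - h) * q.
  move=> h01; have [h0 h1] := andP h01.
  have Xz : X (h *: y + (1 - h) *: x) by apply: convex_set_comb => //; lra.
  have zE : h *: y + (1 - h) *: x - x = h *: (y - x).
    by rewrite scalerBr scalerBl scale1r; apply/rowP => i; rewrite !mxE; ring.
  have := omega_sub Xx Xz; rewrite zE dotZr -/s.
  have := omega_sc Xy Xx h01.
  rewrite -(fineK (omega_fin Xx)) -(fineK (omega_fin Xy)).
  rewrite -(fineK (omega_fin Xz)) -!EFinM -EFinN -!EFinD lee_fin -/q => A B.
  have : h * s <= h * (w y - w x - 2^-1 * (1 - h) * q) by lra.
  by rewrite ler_pM2l.
rewrite /bregman -/s.
have q0 : 0 <= q by rewrite exprn_ge0 ?pnorm_ge0.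
rewrite leNgt; apply/negP => lt_s.
pose e := s - (w y - w x - 2^-1 * q).
have e0 : 0 < e by rewrite /e; lra.
have qe : 0 < 1 + q + e by lra.
(* If the bound failed by [e], this [h] would satisfy [h * q < e]. *)
have h01 : 0 < e / (1 + q + e) < 1.
  by rewrite divr_gt0//= ltr_pdivrMr//; lra.
have := key _ h01.
have : e / (1 + q + e) * q < e.
  by rewrite mulrAC ltr_pdivrMr// ltr_pM2l//; lra.
rewrite /e; lra.
Qed.

Lemma bregman_ge0 x y : X x -> X y -> 0 <= V x y.
Proof.
move=> Xx Xy; apply: le_trans (bregman_ge Xx Xy).
by rewrite mulr_ge0 ?exprn_ge0 ?pnorm_ge0.
Qed.

Lemma bregman_xx x : V x x = 0.
Proof. by rewrite /bregman !subrr dot0r subrr. Qed.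

(** First-order optimality of the prox point, in the direction of [u]. This is
    where [domega] has to be the derivative of [omega] along segments of [X],
    not an arbitrary subgradient. *)
Lemma prox_three_point x xi y u : X x -> is_prox X V x xi y -> X u ->
  dot xi (y - u) <= V x u - V y u - V x y.
Proof.
move=> Xx [Xy ymin] Xu.
have lim := omega_dg.2 y u Xy Xu.
have : dot (domega x) (u - y) - dot xi (u - y) <= dot (domega y) (u - y).
  apply: (cvgr_to_ge lim).
  near=> h.
  have h0 : 0 < h by near: h; exact: nbhs_right_gt.
  have h1 : h < 1 by near: h; exact: nbhs_right_lt.
  have zE : y + h *: (u - y) = h *: u + (1 - h) *: y.
    by apply/rowP => i; rewrite !mxE; ring.
  have Xz : X (y + h *: (u - y)).
    by rewrite zE; apply: convex_set_comb => //; lra.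
  have := ymin _ Xz; rewrite /bregman.
  have -> : y + h *: (u - y) - x = (y - x) + h *: (u - y).
    by apply/rowP => i; rewrite !mxE; ring.
  move=> le_h; rewrite -(ler_pM2l h0) mulrA mulfV ?gt_eqF// mul1r.
  move: le_h; rewrite !dotDr !dotZr !dotDr.
  lra.
rewrite /bregman !dotBr; lra.
Unshelve. all: by end_near. Qed.

Lemma is_prox_uniq x xi y y' : X x ->
  is_prox X V x xi y -> is_prox X V x xi y' -> y = y'.
Proof.
move=> Xx py py'.
have A := prox_three_point Xx py py'.1; have := py'.2 _ py.1.
have B := bregman_ge py.1 py'.1; rewrite !dotBr in A => C.
have : nrm (y' - y) ^+ 2 <= 0 by lra.
rewrite le_eqVlt ltNge exprn_ge0 ?pnorm_ge0// orbF sqrf_eq0 => /eqP.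
by move=> /(pnorm_eq0 p_ge1)/subr0_eq.
Qed.

(** A minimising sequence has a cluster point [q] in [X]. The subgradient of
    [omega] at [q] bounds the objective from below by its value at [q] plus a
    linear function vanishing at [q], so [q] is a minimiser. *)
Lemma is_prox_exists x xi : X x -> exists y, is_prox X V x xi y.
Proof.
move=> Xx; pose h y := V x y + dot xi y.
have xia := dual_norm_bound p_ge1 xi.
set a := dual_norm _ xi in xia.
have hinf : has_inf (h @` X).
  split; first by exists (h x); exists x.
  exists (dot xi x - 2^-1 * a ^+ 2) => _ [y Xy <-].
  have := bregman_ge Xx Xy; have := xia (y - x); rewrite ler_norml.
  move=> /andP[+ _]; rewrite dotBr /h => A B.
  have := sqr_ge0 (nrm (y - x) - a); rewrite sqrrB; lra.
have /choice[u uP] n : exists y, X y /\ h y < inf (h @` X) + n.+1%:R^-1.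
  have n0 : 0 < n.+1%:R^-1 :> R by rewrite invr_gt0.
  have [_ [y Xy <-] hy] := inf_adherent n0 hinf.
  by exists y.
have [q [Xq clq]] : X `&` cluster (u @ \oo) !=set0.
  apply: X_compact; exists 0%N => // n _; exact: (uP n).1.
exists q; split=> // z Xz; rewrite -/(h q) -/(h z).
have hz : inf (h @` X) <= h z by apply: (ge_inf hinf.2); exists z.
apply: le_trans hz; apply/ler_addgt0Pr => e e0.
pose c := domega q - domega x + xi.
have e20 : 0 < e / 2 by lra.
have near_q : \forall y \near q, `|dot c q - dot c y| < e / 2.
  by have /cvgrPdist_lt := continuous_dot (c := c) (x := q); exact.
have near_oo : \forall n \near \oo, n.+1%:R^-1 < e / 2 :> R.
  exact: near_infty_natSinv_lt (PosNum e20).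
have [_ [[n + <-] dq]] : (u @` [set n | n.+1%:R^-1 < e / 2 :> R]) `&`
    [set y | `|dot c q - dot c y| < e / 2] !=set0.
  apply: clq near_q; apply: filterS near_oo => n ?; exact: imageP.
move=> /= dn; have [Xn hn] := uP n.
have := omega_sub Xq Xn.
move: dq hn; rewrite /= ltr_norml => /andP[+ +]; rewrite /c /h /bregman.
rewrite !dotDl !dotNl !dotBr.
move: (inf _) dn => m; move: n.+1%:R^-1 => eps; lra.
Qed.

Definition prox x xi : vec := xget x [set y | is_prox X V x xi y].

Lemma proxP x xi : X x -> is_prox X V x xi (prox x xi).
Proof.
by move=> Xx; have [y yP] := is_prox_exists xi Xx; exact: (xgetI x yP).
Qed.

(** The convex conjugate of the Bregman divergence based at [x]: the largest value
    over [X] of [dot xi (y - x) - V x y], with the prox point as maximiser. It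
    plays the part of half the squared dual norm of [xi], but its smoothness
    comes from [omega], so that no factor depending on the dimension enters. *)
Definition bconj x xi : R :=
  dot xi (prox x (- xi) - x) - V x (prox x (- xi)).

Lemma le_bconj x xi y : X x -> X y -> dot xi (y - x) - V x y <= bconj x xi.
Proof.
move=> Xx Xy; have := (proxP (- xi) Xx).2 y Xy.
by rewrite /bconj !dotNl !dotBr; lra.
Qed.

Lemma bconj_ge0 x xi : X x -> 0 <= bconj x xi.
Proof.
by move=> Xx; have := le_bconj xi Xx Xx; rewrite subrr dot0r bregman_xx subrr.
Qed.

Let half_square (a b c : R) : a <= b * c -> a - 2^-1 * c ^+ 2 <= 2^-1 * b ^+ 2.
Proof. by move=> abc; have := sqr_ge0 (b - c); rewrite sqrrB; lra. Qed.

Lemma bconj_le x xi a : X x -> dbound p a xi -> bconj x xi <= 2^-1 * a ^+ 2.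
Proof.
move=> Xx xia; have [Xy _] := proxP (- xi) Xx.
apply: le_trans (half_square (le_trans (ler_norm _) (xia (prox x (- xi) - x)))).
by rewrite /bconj lerD2l lerN2 bregman_ge.
Qed.

Lemma bconj0 x : X x -> bconj x 0 = 0.
Proof.
move=> Xx; apply/eqP; rewrite eq_le bconj_ge0// andbT.
by have := bconj_le Xx (dbound0 (p := p)); rewrite expr0n mulr0.
Qed.

(** Strong convexity of [omega] with respect to the norm makes its conjugate
    smooth with respect to the dual norm: moving [xi] by [eta] costs a term
    linear in [eta] and half its squared dual norm. *)
Lemma bconj_smooth x xi eta a : X x -> dbound p a eta ->
  bconj x (xi + eta) <=
    bconj x xi + dot eta (prox x (- xi) - x) + 2^-1 * a ^+ 2.
Proof.
move=> Xx etaa.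
have [Xy _] := proxP (- (xi + eta)) Xx.
have px := proxP (- xi) Xx.
rewrite {1}/bconj; set y := prox x (- (xi + eta)) in Xy *.
have := prox_three_point Xx px Xy.
have := half_square (le_trans (ler_norm _) (etaa (y - prox x (- xi)))).
have := bregman_ge px.1 Xy.
rewrite /bconj !dotNl !dotDl !dotBr; lra.
Qed.

Lemma bconj_convex (x xi eta : vec) (t : R) : X x -> 0 <= t <= 1 ->
  bconj x (t *: xi + (1 - t) *: eta) <= t * bconj x xi + (1 - t) * bconj x eta.
Proof.
move=> Xx /andP[t0 t1].
rewrite {1}/bconj; set y := prox _ _.
have [Xy _] := proxP (- (t *: xi + (1 - t) *: eta)) Xx.
have A := le_bconj xi Xx Xy; have B := le_bconj eta Xx Xy.
have := ler_wpM2l t0 A; have t1' : 0 <= 1 - t by lra.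
have := ler_wpM2l t1' B; rewrite -/y dotDl !dotZl; lra.
Qed.

Lemma bconjD x xi eta : X x ->
  bconj x (xi + eta) <= 2^-1 * (bconj x (2 *: xi) + bconj x (2 *: eta)).
Proof.
move=> Xx; have := bconj_convex (2 *: xi) (2 *: eta) (t := 2^-1) Xx.
rewrite !scalerA.
have -> : (2^-1 * 2 = 1 :> R) by rewrite mulVf.
have -> : ((1 - 2^-1) * 2 = 1 :> R) by lra.
rewrite [1 *: xi]scale1r [1 *: eta]scale1r; lra.
Qed.

Lemma bconj_mean x (b : nat) (xi : nat -> vec) : X x -> (0 < b)%N ->
  bconj x (b%:R^-1 *: \sum_(k < b) xi k) <=
    b%:R^-1 * \sum_(k < b) bconj x (xi k).
Proof.
move=> Xx b0; rewrite {1}/bconj; set y := prox _ _.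
have Xy : X y by have [] := proxP (- (b%:R^-1 *: \sum_(k < b) xi k)) Xx.
have -> : V x y = b%:R^-1 * \sum_(k < b) V x y.
  by rewrite sumr_const card_ord -[V x y *+ b]mulr_natl mulrA mulVf ?mul1r// pnatr_eq0 -lt0n.
rewrite dotZl dot_suml -mulrBr ler_wpM2l ?invr_ge0// -sumrB.
by apply: ler_sum => k _; exact: le_bconj.
Qed.

End Bregman.
Arguments prox {R d} X omega domega x xi.
Arguments bconj {R d} X omega domega x xi.

(** * Regret of accelerated mirror descent with inexact gradients *)

Section InexactDescent.
Context {R : realType} {d : nat} {p : R}.
Hypothesis p_ge1 : 1 <= p.
Local Notation vec := 'rV[R]_d.
Local Notation nrm := (@pnorm R d p).
Context {X : set vec} {omega : vec -> \bar R} {domega : vec -> vec}.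
Hypothesis X_compact : compact X.
Hypothesis X_convex : convex_set X.
Hypothesis omega_sc : strongly_convex1 nrm X omega.
Hypothesis omega_dg : distance_gradient X omega domega.
Local Notation V := (bregman omega domega).
Local Notation conj := (@bconj R d X omega domega).
Context {f : vec -> R} {gradf : vec -> vec} {L : R}.
Hypothesis gradf_lip : forall u v, X u -> X v ->
  dbound p (L * nrm (u - v)) (gradf u - gradf v).
Hypothesis f_convex : forall u v, X u -> X v ->
  f v <= f u - dot (gradf v) (u - v).
Implicit Types (x y u v : vec).

(** The convexity inequality, used on the two halves of the segment, bounds the
    increment of [f] by an upper Riemann sum of the integral of its derivative.
    One piece would give the constant [L]; two pieces give [3/4 L], and what
    matters is to stay below [L], so that a share of the Bregman divergence is
    left to absorb the noise. *)
Lemma smooth_upper x y : X x -> X y ->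
  f y <= f x + dot (gradf x) (y - x) + 3 / 4 * L * nrm (y - x) ^+ 2.
Proof.
move=> Xx Xy; pose m := 2^-1 *: x + (1 - 2^-1) *: y.
have Xm : X m by apply: convex_set_comb => //; lra.
have yE : m - y = (- 2^-1) *: (y - x).
  by apply/rowP => i; rewrite !mxE; lra.
have xE : x - m = (- 2^-1) *: (y - x).
  by apply/rowP => i; rewrite !mxE; lra.
have mE : m - x = 2^-1 *: (y - x).
  by apply/rowP => i; rewrite !mxE; lra.
have A := f_convex Xm Xy; have B := f_convex Xx Xm.
rewrite yE dotZr in A; rewrite xE dotZr in B.
have C := le_trans (ler_norm _) (gradf_lip Xy Xx (y - x)).
have := le_trans (ler_norm _) (gradf_lip Xm Xx (y - x)).
rewrite mE pnormZ// gtr0_norm ?invr_gt0// dotBl => D.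
rewrite dotBl in C; lra.
Qed.

(** The error [e] is split as [x - u] plus the move [x' - x]. The first part is
    fixed before [g] is drawn, so only the bias of [g] will matter there. The
    second depends on [g], but the prox step pays [V x x'] for it: three quarters
    of this payment compensate the curvature of [f], and the last quarter turns
    the second part into the conjugate divergence of the error. *)
Lemma accelerated_step (x xf u g x' : vec) (beta gamma : R) :
  let xg := beta^-1 *: x + (1 - beta^-1) *: xf in
  let e := g - gradf xg in
  let xf' := beta^-1 *: x' + (1 - beta^-1) *: xf in
  X x -> X xf -> X u -> 1 <= beta -> 0 < gamma -> 2 * gamma * L <= beta ->
  is_prox X V x (gamma *: g) x' ->
  beta * gamma * (f xf' - f u) + V x' u <=
    (beta - 1) * gamma * (f xf - f u) + V x u
    + (- gamma * dot e (x - u) + 4^-1 * conj x ((- 4 * gamma) *: e)).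
Proof.
move=> xg e xf' Xx Xxf Xu beta1 gamma0 gammaL px.
have Xx' := px.1; have b0 : 0 < beta by lra.
have b01 : 0 <= beta^-1 <= 1 by rewrite invr_ge0 (ltW b0) invf_le1.
have Xxg : X xg by exact: convex_set_comb.
have Xxf' : X xf' by exact: convex_set_comb.
have A := prox_three_point X_convex omega_dg Xx px Xu.
have B := le_bconj p_ge1 X_compact X_convex omega_sc omega_dg
  ((- 4 * gamma) *: e) Xx Xx'.
have C := bregman_ge X_convex omega_sc omega_dg Xx Xx'.
have E1 := f_convex Xxf Xxg; have E2 := f_convex Xu Xxg.
have F := smooth_upper Xxg Xxf'.
have xfE : xf' - xg = beta^-1 *: (x' - x).
  by apply/rowP => i; rewrite !mxE; ring.
have xfE2 : beta *: (xf' - xg) = (beta - 1) *: (xf - xg) + (x' - xg).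
  rewrite /xf'; move: (xg) => h; apply/rowP => i; rewrite !mxE.
  by field; rewrite gt_eqF.
have G := congr1 (dot (gradf xg)) xfE2.
rewrite dotZr (dotDr _ _ (x' - xg)) dotZr in G.
rewrite xfE pnormZ// exprMn real_normK ?num_real// in F.
set N := nrm (x' - x) ^+ 2 in C F.
have N0 : 0 <= N by rewrite exprn_ge0 ?pnorm_ge0.
(* This is where [2 * gamma * L <= beta] enters. *)
have H : beta * gamma * (3 / 4 * L * (beta^-1 ^+ 2 * N)) <= 3 / 8 * N.
  have -> : beta * gamma * (3 / 4 * L * (beta^-1 ^+ 2 * N)) =
      3 / 4 * (gamma * L / beta) * N by field; rewrite gt_eqF.
  apply: ler_wpM2r => //; have : gamma * L / beta <= 2^-1.
    by rewrite ler_pdivrMr//; lra.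
  lra.
have bg : 0 < beta * gamma by rewrite mulr_gt0.
have {}F := ler_wpM2l (ltW bg) F.
have bg1 : 0 <= (beta - 1) * gamma by rewrite mulr_ge0//; lra.
have {}E1 := ler_wpM2l bg1 E1; have {}E2 := ler_wpM2l (ltW gamma0) E2.
have G2 : beta * gamma * dot (gradf xg) (beta^-1 *: (x' - x)) =
   gamma * ((beta - 1) * dot (gradf xg) (xf - xg) + dot (gradf xg) (x' - xg)).
  by rewrite -xfE -G; ring.
have F' : beta * gamma * f xf' <= beta * gamma * f xg +
  gamma * ((beta - 1) * dot (gradf xg) (xf - xg) + dot (gradf xg) (x' - xg))
  + 3 / 4 * V x x'.
  rewrite -G2; apply: (le_trans F); lra.
rewrite dotZl /e !dotBl in B; rewrite dotZl in A.
rewrite /e dotBl.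
have eqs h a b : dot h (a - b) = dot h a - dot h b by rewrite dotBr.
rewrite !eqs in A B E1 E2 F' *.
lra.
Qed.

Lemma mirror_iterate_mem (x xf : nat -> vec) (beta : nat -> R) :
  X (x 0%N) -> X (xf 0%N) -> (forall t, X (x t.+1)) -> (forall t, 1 <= beta t) ->
  (forall t, xf t.+1 = (beta t)^-1 *: x t.+1 + (1 - (beta t)^-1) *: xf t) ->
  forall t, X (x t) /\ X (xf t).
Proof.
move=> Xx0 Xxf0 XxS beta1 xfS; elim=> [//|t [_ Xxf]]; split=> //.
rewrite xfS; apply: convex_set_comb => //.
have bt := lt_le_trans ltr01 (beta1 t).
by rewrite invr_ge0 (ltW bt) invf_le1// beta1.
Qed.

(** The weighted gap telescopes, because the weight [(beta t.+1 - 1) *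
    gamma t.+1] of the next step is at most the weight [beta t * gamma t] that
    this step pays for. *)
Lemma accelerated_regret (x xg xf g : nat -> vec) (beta gamma : nat -> R) u :
  X u -> (forall v, X v -> f u <= f v) ->
  X (x 0%N) -> X (xf 0%N) ->
  (forall t, xg t = (beta t)^-1 *: x t + (1 - (beta t)^-1) *: xf t) ->
  (forall t, is_prox X V (x t) (gamma t *: g t) (x t.+1)) ->
  (forall t, xf t.+1 = (beta t)^-1 *: x t.+1 + (1 - (beta t)^-1) *: xf t) ->
  (forall t, 1 <= beta t) -> beta 0%N = 1 -> (forall t, 0 < gamma t) ->
  (forall t, (beta t.+1 - 1) * gamma t.+1 <= beta t * gamma t) ->
  (forall t, 2 * gamma t * L <= beta t) ->
  forall T, (beta T - 1) * gamma T * (f (xf T) - f u) <=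
    V (x 0%N) u + \sum_(0 <= t < T)
      (- gamma t * dot (g t - gradf (xg t)) (x t - u)
       + 4^-1 * conj (x t) ((- 4 * gamma t) *: (g t - gradf (xg t)))).
Proof.
move=> Xu u_min Xx0 Xxf0 xgE px xfS beta1 beta0 gamma0 betaS gammaL T.
have mem := mirror_iterate_mem Xx0 Xxf0 (fun t => (px t).1) beta1 xfS.
suff : (beta T - 1) * gamma T * (f (xf T) - f u) + V (x T) u <=
    V (x 0%N) u + \sum_(0 <= t < T)
      (- gamma t * dot (g t - gradf (xg t)) (x t - u)
       + 4^-1 * conj (x t) ((- 4 * gamma t) *: (g t - gradf (xg t)))).
  by have := bregman_ge0 X_convex omega_sc omega_dg (mem T).1 Xu; lra.
elim: T => [|T IH]; first by rewrite big_geq// beta0; lra.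
rewrite big_nat_recr//=.
have [XxT XxfT] := mem T.
have := accelerated_step XxT XxfT Xu (beta1 T) (gamma0 T) (gammaL T) (px T).
rewrite -xgE -xfS => step.
have : (beta T.+1 - 1) * gamma T.+1 * (f (xf T.+1) - f u) <=
    beta T * gamma T * (f (xf T.+1) - f u).
  by rewrite ler_wpM2r// subr_ge0; apply: u_min; have [] := mem T.+1.
lra.
Qed.

End InexactDescent.

(** * Integrals of functions of countable data *)

Section CountablyMeasurable.
Context {dT : measure_display} {T : measurableType dT}.

(** Every random quantity of the algorithm is determined by finitely many states
    and levels, hence is a function of a measurable code in [nat]. All preimages
    under such a map are measurable, whatever its codomain. *)
Definition cmap (U : Type) (H : T -> U) :=
  exists2 Y : T -> nat, (forall k, measurable (Y @^-1` [set k])) &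
    forall w w', Y w = Y w' -> H w = H w'.

Lemma cmap_cst (U : Type) (u : U) : cmap (fun=> u).
Proof.
by exists (fun=> 0%N) => // k; rewrite preimage_cst; case: ifP.
Qed.

Lemma cmap_factor (U U' : Type) (H : T -> U) (H' : T -> U') :
  cmap H -> (forall w w', H w = H w' -> H' w = H' w') -> cmap H'.
Proof. by move=> [Y mY YH] HH'; exists Y => // w w' /YH /HH'. Qed.

Lemma cmap_comp (U U' : Type) (H : T -> U) (h : U -> U') :
  cmap H -> cmap (h \o H).
Proof. by move=> /cmap_factor; apply => w w' /= ->. Qed.

Lemma cmap_preimage (U : Type) (H : T -> U) (S : set U) :
  cmap H -> measurable (H @^-1` S).
Proof.
move=> [Y mY YH].
have -> : H @^-1` S = \bigcup_(k in [set k | exists2 w, Y w = k & S (H w)])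
    (Y @^-1` [set k]).
  apply/seteqP; split=> [w Sw|w [k [w' Yw' Sw']] Yw].
    by exists (Y w) => //; exists w.
  by rewrite /= (YH w w')// Yw'.
by apply: bigcup_measurable.
Qed.

Lemma cmap_bind (U : Type) (N : T -> nat) (H : nat -> T -> U) :
  cmap N -> (forall n, cmap (H n)) -> cmap (fun w => H (N w) w).
Proof.
move=> cN cH.
have /choice[Y YP] n : exists Y : T -> nat,
    (forall k, measurable (Y @^-1` [set k])) /\
    forall w w', Y w = Y w' -> H n w = H n w'.
  by have [Y] := cH n; exists Y.
have p_inj := pcan_inj (@pickleK (nat * nat)%type).
exists (fun w => pickle (N w, Y (N w) w)) => [k|w w']; last first.
  by move=> /p_inj[<-]; exact: (YP (N w)).2.
have [[[a b] abk]|none] := pselect (exists ab : nat * nat, pickle ab = k).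
  have -> : (fun w => pickle (N w, Y (N w) w)) @^-1` [set k] =
      (N @^-1` [set a]) `&` (Y a @^-1` [set b]).
    apply/seteqP; split=> w /=; first by rewrite -abk => /p_inj[<- <-].
    by move=> [-> ->].
  by apply: measurableI; [exact: cmap_preimage|exact: (YP a).1].
suff -> : (fun w => pickle (N w, Y (N w) w)) @^-1` [set k] = set0.
  exact: measurable0.
by apply/seteqP; split=> // w wk; apply: none; exists (N w, Y (N w) w).
Qed.

Lemma cmap_pair (U U' : Type) (H : T -> U) (H' : T -> U') :
  cmap H -> cmap H' -> cmap (fun w => (H w, H' w)).
Proof.
move=> [Y mY YH] [Y' mY' YH'].
apply: (@cmap_factor (nat * nat) _ (fun w => (Y w, Y' w))); last first.
  by move=> w w' [/YH -> /YH' ->].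
apply: (cmap_bind (N := Y) (H := fun n w => (n, Y' w))); first by exists Y.
by move=> n; apply: (@cmap_factor nat _ Y'); [exists Y'|move=> w w' ->].
Qed.

Lemma cmap_comp2 (U1 U2 U' : Type) (H1 : T -> U1) (H2 : T -> U2)
    (h : U1 -> U2 -> U') :
  cmap H1 -> cmap H2 -> cmap (fun w => h (H1 w) (H2 w)).
Proof.
by move=> /cmap_pair/[apply] /cmap_factor; apply=> w w' [-> ->].
Qed.

Lemma cmap_sum (V : nmodType) (I : Type) (r : seq I) (Q : pred I)
    (F : I -> T -> V) :
  (forall i, cmap (F i)) -> cmap (fun w => \sum_(i <- r | Q i) F i w).
Proof.
move=> cF; elim: r => [|i r IH].
  apply: (cmap_factor (cmap_cst tt)) => w w' _; by rewrite !big_nil.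
apply: (cmap_factor (cmap_pair (cF i) IH)) => w w' [e1 e2].
by rewrite !big_cons e1 e2.
Qed.

End CountablyMeasurable.

Section BoundedIntegral.
Context {R : realType} {dT : measure_display} {T : measurableType dT}.
Context {mu : {measure set T -> \bar R}}.
Hypothesis mu1 : mu setT = 1%E.
Implicit Types (A : set T) (H : T -> R).

Definition bounded_cmap H := cmap H /\ exists c, forall w, `|H w| <= c.

Lemma measure_fin A : measurable A -> mu A \is a fin_num.
Proof.
move=> mA; rewrite ge0_fin_numE//; apply: (@le_lt_trans _ _ (mu setT)).
  by apply: le_measure; rewrite ?inE.
by rewrite mu1 ltry.
Qed.

Lemma bounded_cmap_cst c : bounded_cmap (fun=> c).
Proof. by split; [exact: cmap_cst|exists `|c|]. Qed.

Lemma bounded_cmapD H1 H2 : bounded_cmap H1 -> bounded_cmap H2 ->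
  bounded_cmap (fun w => H1 w + H2 w).
Proof.
move=> [m1 [c1 b1]] [m2 [c2 b2]]; split; first exact: cmap_comp2.
by exists (c1 + c2) => w; rewrite (le_trans (ler_normD _ _))// lerD.
Qed.

Lemma bounded_cmapM H1 H2 : bounded_cmap H1 -> bounded_cmap H2 ->
  bounded_cmap (fun w => H1 w * H2 w).
Proof.
move=> [m1 [c1 b1]] [m2 [c2 b2]]; split; first exact: cmap_comp2.
by exists (c1 * c2) => w; rewrite normrM ler_pM.
Qed.

Lemma bounded_cmapZ c H : bounded_cmap H -> bounded_cmap (fun w => c * H w).
Proof. by apply: bounded_cmapM; exact: bounded_cmap_cst. Qed.

Lemma bounded_cmap_sum (I : Type) (r : seq I) (Q : pred I) (F : I -> T -> R) :
  (forall i, bounded_cmap (F i)) ->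
  bounded_cmap (fun w => \sum_(i <- r | Q i) F i w).
Proof.
move=> cF; split; first by apply: cmap_sum => i; have [] := cF i.
have /choice[c cP] i : exists c, forall w, `|F i w| <= c by have [] := cF i.
exists (\sum_(i <- r | Q i) c i) => w; apply: (le_trans (ler_norm_sum _ _ _)).
by apply: ler_sum => i _.
Qed.

Lemma bounded_cmap_integrable A H : measurable A -> bounded_cmap H ->
  mu.-integrable A (EFin \o H).
Proof.
move=> mA [cH [c Hc]]; apply: measurable_bounded_integrable => //.
- by rewrite -ge0_fin_numE// measure_fin.
- by move=> _ S _; apply: measurableI => //; exact: cmap_preimage.
- exists c; split; rewrite ?num_real// => x cx w _.
  exact: le_trans (Hc w) (ltW cx).
Qed.

(** A countable partition by the values of [Y] reduces a comparison of integrals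
    to the pieces: conditioning, without conditional expectations. *)
Lemma le_integral_fibers (U : Type) (Y : T -> U) A H1 H2 :
  countable [set: U] -> cmap Y ->
  measurable A -> bounded_cmap H1 -> bounded_cmap H2 ->
  (forall y, \int[mu]_(w in A `&` Y @^-1` [set y]) H1 w <=
             \int[mu]_(w in A `&` Y @^-1` [set y]) H2 w) ->
  \int[mu]_(w in A) H1 w <= \int[mu]_(w in A) H2 w.
Proof.
move=> /countable_injP[g g_inj] cY mA bH1 bH2 le12; pose C := g \o Y.
have mF k : measurable (A `&` C @^-1` [set k]).
  by apply: measurableI => //; apply: cmap_preimage; exact: cmap_comp.
have bB : bounded_cmap (fun w => H2 w - H1 w).
  apply: bounded_cmapD => //; under eq_fun do rewrite -mulN1r.
  exact: bounded_cmapZ.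
rewrite -subr_ge0 -RintegralB//; try exact: bounded_cmap_integrable.
have AE : A = \bigcup_k (A `&` C @^-1` [set k]).
  rewrite -setI_bigcupr; apply/seteqP; split=> [w Aw|w []//].
  by split=> //; exists (C w).
have iB := bounded_cmap_integrable mA bB.
rewrite /Rintegral [X in integral _ X]AE.
rewrite integral_bigcup//; last by rewrite -AE.
  apply: fine_ge0; apply: nneseries_ge0 => k _ _.
  rewrite -[X in (_ <= X)%E]fineK; last first.
    by apply: integrable_fin_num => //; exact: bounded_cmap_integrable.
  rewrite lee_fin -/(Rintegral _ _ _) RintegralB//; last 2 first.
    exact: bounded_cmap_integrable.
    exact: bounded_cmap_integrable.
  rewrite subr_ge0.
  have [[w [Aw Cw]]|none] := pselect ((A `&` C @^-1` [set k]) !=set0).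
    suff -> : C @^-1` [set k] = Y @^-1` [set Y w] by exact: le12.
    rewrite -Cw; apply/seteqP; split=> w' /=; last by rewrite /C /= => ->.
    by move=> /g_inj; apply; rewrite in_setT.
  rewrite (_ : A `&` C @^-1` [set k] = set0) ?Rintegral_set0//.
  by apply/seteqP; split=> // w Aw; apply: none; exists w.
apply/trivIsetP => i j _ _ ij; apply/seteqP; split=> // w [[_ iw] [_ jw]].
by move: ij; rewrite -iw -jw eqxx.
Qed.

Lemma eq_integral_fibers (U : Type) (Y : T -> U) A H1 H2 :
  countable [set: U] -> cmap Y ->
  measurable A -> bounded_cmap H1 -> bounded_cmap H2 ->
  (forall y, \int[mu]_(w in A `&` Y @^-1` [set y]) H1 w =
             \int[mu]_(w in A `&` Y @^-1` [set y]) H2 w) ->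
  \int[mu]_(w in A) H1 w = \int[mu]_(w in A) H2 w.
Proof.
move=> cU cY mA b1 b2 e12; apply/eqP; rewrite eq_le.
by apply/andP; split; apply: (le_integral_fibers cU cY) => // y; rewrite e12.
Qed.

Lemma bounded_integral_linear A a H1 H2 : measurable A ->
  bounded_cmap H1 -> bounded_cmap H2 ->
  \int[mu]_(w in A) (a * H1 w + H2 w) =
  a * \int[mu]_(w in A) H1 w + \int[mu]_(w in A) H2 w.
Proof.
move=> mA b1 b2; rewrite RintegralD//; last 2 first.
- by apply: bounded_cmap_integrable => //; exact: bounded_cmapZ.
- exact: bounded_cmap_integrable.
by rewrite RintegralZl//; exact: bounded_cmap_integrable.
Qed.

Lemma bounded_integral_le A H1 H2 : measurable A ->
  bounded_cmap H1 -> bounded_cmap H2 -> (forall w, A w -> H1 w <= H2 w) ->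
  \int[mu]_(w in A) H1 w <= \int[mu]_(w in A) H2 w.
Proof.
by move=> mA b1 b2 le12; apply: le_Rintegral => //;
  exact: bounded_cmap_integrable.
Qed.

Lemma bounded_integral_sum A (I : Type) (r : seq I) (F : I -> T -> R) :
  measurable A -> (forall i, bounded_cmap (F i)) ->
  \int[mu]_(w in A) (\sum_(i <- r) F i w) =
  \sum_(i <- r) \int[mu]_(w in A) F i w.
Proof.
move=> mA bF; elim: r => [|i r IH].
  rewrite big_nil; under eq_Rintegral do rewrite big_nil.
  by rewrite Rintegral_cst// mul0r.
rewrite big_cons -IH; under eq_Rintegral do rewrite big_cons -[F _ _]mul1r.
by rewrite bounded_integral_linear ?mul1r//; exact: bounded_cmap_sum.
Qed.

End BoundedIntegral.

(** * Laws on a countable space *)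

Section Means.
Context {R : realType} {Z : choiceType}.
Implicit Types (phi psi : Z -> R) (s : seq Z).

Definition bounded phi := exists c, forall z, `|phi z| <= c.

Definition pt (a z : Z) : R := (z == a)%:R.

(** Laws on [Z], seen through the integrals of bounded functions. Measures, kernels
    and conditional laws can be compared in this form without being turned into
    measures first. *)
Record is_mean (E : (Z -> R) -> R) : Prop := {
  mean_linear : forall a phi psi, bounded phi -> bounded psi ->
    E (fun z => a * phi z + psi z) = a * E phi + E psi ;
  mean_ge0 : forall phi, bounded phi -> (forall z, 0 <= phi z) -> 0 <= E phi ;
  mean_1 : E (fun=> 1) = 1
}.

Definition tight (E : (Z -> R) -> R) :=
  forall e : R, 0 < e -> exists2 s, uniq s & 1 - e <= \sum_(a <- s) E (pt a).

Lemma bounded_cst (c : R) : bounded (fun=> c).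
Proof. by exists `|c|. Qed.

Lemma boundedD phi psi : bounded phi -> bounded psi ->
  bounded (fun z => phi z + psi z).
Proof.
move=> [c Hc] [c' Hc']; exists (c + c') => z.
by rewrite (le_trans (ler_normD _ _))// lerD.
Qed.

Lemma boundedM phi psi : bounded phi -> bounded psi ->
  bounded (fun z => phi z * psi z).
Proof.
move=> [c Hc] [c' Hc']; exists (c * c') => z.
by rewrite normrM ler_pM.
Qed.

Lemma boundedZ c phi : bounded phi -> bounded (fun z => c * phi z).
Proof. by apply: boundedM; exact: bounded_cst. Qed.

Lemma bounded_sum (I : Type) (r : seq I) (F : I -> Z -> R) :
  (forall i, bounded (F i)) -> bounded (fun z => \sum_(i <- r) F i z).
Proof.
move=> bF; elim: r => [|i r IH].
  by exists 0 => z; rewrite big_nil normr0.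
under eq_fun do rewrite big_cons; exact: boundedD.
Qed.

Lemma bounded_nat (b : Z -> bool) : bounded (fun z => (b z)%:R).
Proof. by exists 1 => z; case: (b z); rewrite ?normr0 ?normr1. Qed.

Section MeanTheory.
Context {E : (Z -> R) -> R}.
Hypothesis mE : is_mean E.

Lemma mean_cst (c : R) : E (fun=> c) = c.
Proof.
have E0 : E (fun=> 0) = 0.
  have := mean_linear mE (-1) (bounded_cst 0) (bounded_cst 0).
  by rewrite mulr0 addr0 mulN1r addNr.
have := mean_linear mE c (bounded_cst 1) (bounded_cst 0).
by rewrite mean_1// E0 mulr1 !addr0.
Qed.

Lemma meanD phi psi : bounded phi -> bounded psi ->
  E (fun z => phi z + psi z) = E phi + E psi.
Proof.
move=> b1 b2; rewrite -[E phi]mul1r -mean_linear//.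
by under [in RHS]eq_fun do rewrite mul1r.
Qed.

Lemma meanZ c phi : bounded phi -> E (fun z => c * phi z) = c * E phi.
Proof.
move=> b1; have := mean_linear mE c b1 (bounded_cst 0).
by rewrite mean_cst addr0; under eq_fun do rewrite addr0.
Qed.

Lemma mean_sum (I : Type) (r : seq I) (F : I -> Z -> R) :
  (forall i, bounded (F i)) ->
  E (fun z => \sum_(i <- r) F i z) = \sum_(i <- r) E (F i).
Proof.
move=> bF; elim: r => [|i r IH].
  by rewrite big_nil -[RHS](mean_cst 0); under eq_fun do rewrite big_nil.
rewrite big_cons -IH -meanD//; last exact: bounded_sum.
by under eq_fun do rewrite big_cons.
Qed.

Lemma mean_le phi psi : bounded phi -> bounded psi ->
  (forall z, phi z <= psi z) -> E phi <= E psi.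
Proof.
move=> b1 b2 le12.
have := mean_ge0 mE (boundedD (boundedZ (-1) b1) b2).
rewrite mean_linear// => H; rewrite -subr_ge0 addrC -mulN1r; apply: H => z.
by rewrite mulN1r addrC subr_ge0.
Qed.

Lemma mean_norm_le c phi psi : bounded psi ->
  (forall z, `|phi z| <= c * psi z) -> `|E phi| <= c * E psi.
Proof.
move=> b2 H.
have b1 : bounded phi.
  have [c' H'] := boundedZ c b2; exists c' => z.
  by rewrite (le_trans (H z))// (le_trans (ler_norm _)).
rewrite ler_norml -mulNr -!meanZ//; apply/andP; split; apply: mean_le => //;
  try exact: boundedZ; move=> z; have := H z; rewrite ler_norml; lra.
Qed.

Lemma mean_bound c phi : (forall z, `|phi z| <= c) -> `|E phi| <= c.
Proof.
move=> H; rewrite -[X in _ <= X]mulr1 -(mean_1 mE).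
by apply: mean_norm_le; [exact: bounded_cst|move=> z; rewrite mulr1].
Qed.

End MeanTheory.

(** A bounded function is a combination of the point masses in [s] plus its
    restriction to the complement of [s]. The mass of that complement is one minus
    the masses in [s], so it is small for [E1] as soon as it is for [E2]. *)
Lemma mean_close E1 E2 s (e c : R) phi : is_mean E1 -> is_mean E2 -> uniq s ->
  \sum_(a <- s) `|E1 (pt a) - E2 (pt a)| <= e ->
  1 - e <= \sum_(a <- s) E2 (pt a) ->
  0 <= c -> (forall z, `|phi z| <= c) -> `|E1 phi - E2 phi| <= 4 * e * c.
Proof.
move=> m1 m2 us close12 tail2 c0 phic.
have bphi : bounded phi by exists c.
have bpt a : bounded (pt a) by exact: bounded_nat.
pose r z : R := (z \notin s)%:R.
have br : bounded r by exact: bounded_nat.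
have sum_pt (h : Z -> R) z : \sum_(a <- s) h a * pt a z =
    (z \in s)%:R * h z.
  have [zs|zNs] := boolP (z \in s).
    rewrite (bigD1_seq z)//= /pt eqxx mulr1 big1 ?addr0 ?mul1r// => a az.
    by rewrite eq_sym (negbTE az) mulr0.
  rewrite mul0r big_seq big1// => a ains; rewrite /pt.
  by case: eqP ains zNs => [->->|]; rewrite ?mulr0.
have bsum h : bounded (fun z => \sum_(a <- s) h a * pt a z).
  by apply: bounded_sum => a; exact: boundedZ.
have decomp E : is_mean E -> E phi =
    \sum_(a <- s) phi a * E (pt a) + E (fun z => r z * phi z).
  move=> mE; under eq_bigr do rewrite -(meanZ mE)//.
  rewrite -mean_sum//; last by move=> a; exact: boundedZ.
  rewrite -meanD//; last exact: boundedM.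
  congr (E _); apply/funext => z; rewrite sum_pt /r -mulrDl.
  by case: (z \in s); rewrite ?addr0 ?add0r mul1r.
have tailE E : is_mean E -> E r = 1 - \sum_(a <- s) E (pt a).
  move=> mE; rewrite -mean_sum// -[X in X - _](mean_1 mE).
  rewrite -[X in _ - X]mul1r -mulNr addrC -(mean_linear mE)//; last 2 first.
    by apply: bounded_sum.
    exact: bounded_cst.
  congr (E _); apply/funext => z.
  have := sum_pt (fun=> 1) z; under eq_bigr do rewrite mul1r.
  by move=> ->; rewrite /r; case: (z \in s); rewrite /= ?mulr1 ?mulr0; lra.
have tail E : is_mean E -> `|E (fun z => r z * phi z)| <= c * E r.
  move=> mE; apply: mean_norm_le => // z.
  rewrite normrM /r normr_nat mulrC ler_wpM2r//.
have := tail _ m1; have := tail _ m2; rewrite !tailE//.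
rewrite (decomp _ m1) (decomp _ m2) => t2 t1.
have s12 : `|\sum_(a <- s) phi a * E1 (pt a) - \sum_(a <- s) phi a * E2 (pt a)|
    <= c * \sum_(a <- s) `|E1 (pt a) - E2 (pt a)|.
  rewrite -sumrB mulr_sumr; apply: (le_trans (ler_norm_sum _ _ _)).
  by apply: ler_sum => a _; rewrite -mulrBr normrM ler_wpM2r.
have s21 : \sum_(a <- s) E2 (pt a) - \sum_(a <- s) E1 (pt a) <= e.
  apply: le_trans close12; rewrite -sumrB; apply: ler_sum => a _.
  by rewrite distrC ler_norm.
have ce : c * \sum_(a <- s) `|E1 (pt a) - E2 (pt a)| <= c * e.
  by rewrite ler_wpM2l.
have ce2 : c * (1 - \sum_(a <- s) E2 (pt a)) <= c * e.
  by rewrite ler_wpM2l//; lra.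
have ce1 : c * (1 - \sum_(a <- s) E1 (pt a)) <= c * (2 * e).
  by rewrite ler_wpM2l//; lra.
move: s12 t1 t2; rewrite !ler_norml; lra.
Qed.

Lemma mean_eq E1 E2 phi : is_mean E1 -> is_mean E2 -> tight E2 ->
  (forall a, E1 (pt a) = E2 (pt a)) -> bounded phi -> E1 phi = E2 phi.
Proof.
move=> m1 m2 t2 e12 [c phic]; apply/eqP; rewrite -subr_eq0 -normr_le0.
apply/ler_addgt0Pr => e e0; rewrite add0r.
pose c' := Num.max c 1.
have c'1 : 1 <= c' by rewrite le_max lexx orbT.
have [] := t2 (e / (4 * c')); first by rewrite divr_gt0//; lra.
move=> s us ts.
have -> : e = 4 * (e / (4 * c')) * c' by field; rewrite gt_eqF//; lra.
apply: mean_close us _ ts _ _ => //.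
- rewrite big1 ?divr_ge0//; try lra.
  by move=> a _; rewrite e12 subrr normr0.
- by lra.
- by move=> z; rewrite (le_trans (phic z))// le_max lexx.
Qed.

End Means.

(** * The transition operator and its contraction *)

Section KernelOperator.
Context {R : realType} {dZ : measure_display} {Z : measurableType dZ}.
Hypothesis Z_countable : countable [set: Z].
Hypothesis Z_discrete : forall z : Z, measurable [set z].
Implicit Types (phi psi : Z -> R) (K : R.-pker Z ~> Z).

Lemma cmap_id : cmap (@id Z).
Proof.
have /countable_injP[g g_inj] := Z_countable.
exists g => [k|w w' /g_inj]; last by apply; rewrite in_setT.
have [[z zk]|none] := pselect (exists z, g z = k).
  have -> : g @^-1` [set k] = [set z]; last exact: Z_discrete.
  apply/seteqP; split=> w /=; last by move=> ->.
  by rewrite -zk => /g_inj; apply; rewrite in_setT.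
have -> : g @^-1` [set k] = set0; last exact: measurable0.
by apply/seteqP; split=> // w wk; apply: none; exists w.
Qed.

Lemma bounded_cmap_fun phi : bounded phi -> bounded_cmap phi.
Proof. by move=> b; split=> //; exact: (cmap_comp _ cmap_id). Qed.

Lemma measurable_discrete (A : set Z) : measurable A.
Proof. exact: (cmap_preimage A cmap_id). Qed.

Section Law.
Context {mu : {measure set Z -> \bar R}}.
Hypothesis mu1 : mu setT = 1%E.

Lemma integral_is_mean : is_mean (fun phi => \int[mu]_z phi z).
Proof.
split=> [a phi psi b1 b2|phi b0 phi0|].
- by apply: bounded_integral_linear => //; exact: bounded_cmap_fun.
- exact: Rintegral_ge0.
- by rewrite Rintegral_cst// mu1 mulr1.
Qed.

Lemma integral_pt a : \int[mu]_z pt a z = fine (mu [set a]).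
Proof.
rewrite -[in RHS](setIT [set a]) -integral_indic//.
congr fine; apply: eq_integral => z _; congr EFin.
by rewrite /pt indicE in_set1.
Qed.

Lemma integral_tight : tight (fun phi => \int[mu]_z phi z).
Proof.
move=> e e0; have /countable_injP[g g_inj] := Z_countable.
pose F n := [set z | (g z < n)%N].
have Fseq n : exists2 s, uniq s & forall z, (z \in s) = (g z < n)%N.
  elim: n => [|n [s us sP]]; first by exists [::].
  have [[a an]|none] := pselect (exists a, g a = n).
    exists (a :: s); first by rewrite /= us sP an ltnn.
    move=> z; rewrite inE sP ltnS [RHS]leq_eqVlt -an; congr (_ || _).
    apply/eqP/eqP => [->//|]; by move/g_inj; apply; rewrite in_setT.
  exists s => // z; rewrite sP ltnS [RHS]leq_eqVlt; case: eqP => //= zn.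
  by exfalso; apply: none; exists z.
have FT : \bigcup_n F n = setT.
  by apply/seteqP; split=> // z _; exists (g z).+1 => //=; rewrite /F /= ltnSn.
have : mu (F n) @[n --> \oo] --> 1%E.
  rewrite -mu1 -FT; apply: nondecreasing_cvg_mu => [n||n m nm].
  - exact: measurable_discrete.
  - exact: measurable_discrete.
  - by apply/subsetPset => z /= /leq_trans; exact.
move=> /fine_cvgP[_ /cvgr_ge cvF].
have [n Fn] : exists n, 1 - e <= fine (mu (F n)).
  apply: (@filter_ex _ \oo); apply: cvF; lra.
have [s us sP] := Fseq n; exists s => //; apply: (le_trans Fn).
rewrite -(mean_sum integral_is_mean); last by move=> a; exact: bounded_nat.
rewrite -[F n]setIT -integral_indic//; last exact: measurable_discrete.
rewrite le_eqVlt; apply/orP; left; apply/eqP.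
congr fine; apply: eq_integral => z _; congr EFin.
have zF : (z \in F n) = (z \in s).
  by rewrite sP; apply/idP/idP => [/set_mem//|?]; exact: mem_set.
rewrite indicE zF; have [zs|zNs] := boolP (z \in s).
  rewrite (bigD1_seq z)//= /pt eqxx big1 ?addr0// => a az.
  by rewrite eq_sym (negbTE az).
rewrite big_seq big1// => a ains; rewrite /pt.
by case: eqP ains zNs => [->->|].
Qed.

End Law.

Lemma kernel_is_mean K z : is_mean (fun phi => \int[K z]_y phi y).
Proof. exact: (integral_is_mean (prob_kernel z)). Qed.

(** [transition K t phi z] is the conditional expectation of [phi (Z_t)] given
    that [Z_0 = z], for the chain with kernel [K]. *)
Definition transition K (t : nat) phi : Z -> R :=
  iter t (fun psi z => \int[K z]_y psi y) phi.

Lemma transition_bound K t phi c : (forall z, `|phi z| <= c) ->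
  forall z, `|transition K t phi z| <= c.
Proof.
move=> Hc; elim: t => [//|t IH] z.
exact: (mean_bound (kernel_is_mean K z) IH).
Qed.

Lemma transition_bounded K t phi : bounded phi -> bounded (transition K t phi).
Proof. by move=> [c Hc]; exists c; exact: transition_bound. Qed.

Lemma transitionD K s t phi :
  transition K (s + t) phi = transition K s (transition K t phi).
Proof. exact: iterD. Qed.

Lemma transition_is_mean K t z : is_mean (fun phi => transition K t phi z).
Proof.
split=> [a phi psi b1 b2|phi b0 phi0|].
- elim: t z => [//|t IH] z /=.
  rewrite -(mean_linear (kernel_is_mean K z));
    try exact: transition_bounded.
  by congr Rintegral; apply/funext => y; rewrite IH.
- elim: t z => [//|t IH] z /=.
  apply: (mean_ge0 (kernel_is_mean K z)) => //.
  exact: transition_bounded.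
- elim: t z => [//|t IH] z /=.
  rewrite -[RHS](mean_1 (kernel_is_mean K z)).
  by congr Rintegral; apply/funext => y; rewrite IH.
Qed.

Lemma kernel_iterE K t z a :
  kernel_iter K t z [set a] = (transition K t (pt a) z)%:E.
Proof.
elim: t z => [|t IH] z /=.
  by rewrite diracE in_set1.
under eq_integral do rewrite IH.
rewrite /Rintegral fineK//; apply: integrable_fin_num => //.
apply: (bounded_cmap_integrable (prob_kernel z)) => //.
by apply: bounded_cmap_fun; apply: transition_bounded; exact: bounded_nat.
Qed.

Lemma invariant_mean K (pi : probability Z R) t phi : invariant_law K pi ->
  bounded phi -> \int[pi]_z transition K t phi z = \int[pi]_z phi z.
Proof.
move=> Kpi bphi; elim: t => [//|t <-] /=.
have btr := transition_bounded K t bphi.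
have mpi := integral_is_mean (probability_setT pi).
apply: (@mean_eq _ _
  (fun psi => \int[pi]_z (\int[K z]_y psi y)) (fun psi => \int[pi]_z psi z))
  => //.
- split=> [a f g b1 b2|f b0 f0|].
  + rewrite -(mean_linear mpi); try exact: (transition_bounded K 1).
    congr Rintegral; apply/funext => z.
    exact: (mean_linear (kernel_is_mean K z)).
  + apply: (mean_ge0 mpi) => [|z]; first exact: (transition_bounded K 1).
    exact: (mean_ge0 (kernel_is_mean K z)).
  + rewrite -[RHS](mean_1 mpi); congr Rintegral; apply/funext => z.
    exact: (mean_1 (kernel_is_mean K z)).
- exact: integral_tight (probability_setT pi).
move=> a; rewrite integral_pt.
apply: etrans (congr1 fine (Kpi [set a] (Z_discrete a))); congr fine.
apply: eq_integral => z _; rewrite integral_pt fineK//.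
exact: measure_fin (prob_kernel z) _ _.
Qed.

(** Pointwise convergence of the masses at rate [C0 * 2^-(t/tau)] gives no
    rate in total variation when the space is infinite. A finite set that carries
    most of [pi] gives, after a number [c] of mixing times that depends only on
    [pi] and [C0], a total variation distance below a fixed constant; the
    semigroup property then restores geometric decay. *)
Lemma mixing_blocks (pi : probability Z R) (C0 : R) : 0 < C0 ->
  exists2 c, (0 < c)%N & forall K tau, (0 < tau)%N ->
    geometrically_ergodic K pi C0 tau ->
    forall phi (M : R) z, 0 <= M -> (forall z, `|phi z| <= M) ->
    `|transition K (c * tau) phi z - \int[pi]_z phi z| <= M / 4.
Proof.
move=> C0_gt0.
have [s us tail] : exists2 s, uniq s &
    1 - 16^-1 <= \sum_(a <- s) \int[pi]_z pt a z.
  by apply: (integral_tight (probability_setT pi)); rewrite invr_gt0.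
(* With [c] chosen so that [C0 * 2^-c * size s <= 1/16], the distance between the
   two laws is at most [4 / 16], which is the factor wanted. *)
pose y := 16 * C0 * (size s)%:R.
exists (Num.truncn y).+1 => // K tau tau0 erg phi M z M0 phiM.
set c := (Num.truncn y).+1.
have yc : y <= 2 ^+ c.
  apply/ltW/(lt_trans (truncnS_gt _)).
  by rewrite -natrX ltr_nat ltn_expl.
have -> : M / 4 = 4 * 16^-1 * M by lra.
apply: (mean_close (transition_is_mean K (c * tau) z)
  (integral_is_mean (probability_setT pi)) us _ tail M0 phiM).
have le_each a : `|transition K (c * tau) (pt a) z - \int[pi]_z pt a z| <=
    C0 * 2^-1 ^+ c.
  have := erg (c * tau)%N z a; rewrite muln_gt0 tau0 => /(_ isT).
  rewrite kernel_iterE integral_pt natrM mulfK ?pnatr_eq0 -?lt0n//.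
  by rewrite powR_mulrn.
apply: (le_trans (ler_sum _ (fun a _ => le_each a))).
rewrite big_const_seq count_predT iter_addr_0 -[_ *+ size s]mulr_natr.
rewrite exprVn mulrAC ler_pdivrMr ?exprn_gt0//.
by rewrite /y in yc; lra.
Qed.

End KernelOperator.

(** * Histories and the Markov property *)

Definition upd (U : Type) (u : nat -> U) (k : nat) (v : U) : nat -> U :=
  fun i => if i == k then v else u i.

Lemma upd_same (U : Type) (u : nat -> U) k v : upd u k v k = v.
Proof. by rewrite /upd eqxx. Qed.

Lemma upd_lt (U : Type) (u : nat -> U) k v i : (i < k)%N -> upd u k v i = u i.
Proof. by move=> ik; rewrite /upd ltn_eqF. Qed.

Lemma path_eventS (dO : measure_display) (Om : measurableType dO) (U : Type)
    (Y : nat -> Om -> U) n u v :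
  path_event Y n.+1 (upd u n v) = path_event Y n u `&` [set w | Y n w = v].
Proof.
apply/seteqP; split=> [w Yw|w [Yw Yn] i]; first split=> [i lt_in|].
- by rewrite (Yw i (leqW lt_in)) upd_lt.
- by rewrite /= Yw// upd_same.
by rewrite ltnS leq_eqVlt => /predU1P[->|lt_in];
  rewrite ?upd_same// upd_lt// Yw.
Qed.

Section History.
Context {R : realType} {dZ : measure_display} {Z : measurableType dZ}.
Hypothesis Z_countable : countable [set: Z].
Hypothesis Z_discrete : forall z : Z, measurable [set z].
Context {nu : probability Z R} {K : R.-pker Z ~> Z}.
Context {dO : measure_display} {Om : measurableType dO} {P : probability Om R}.
Context {Zt : nat -> {RV P >-> Z}} {J : nat -> {RV P >-> nat}}.
Hypothesis chain : stationary_markov_chain K nu Zt.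
Hypothesis indep : independent_geometric Zt J.
Implicit Types (z : nat -> Z) (j : nat -> nat) (phi : Z -> R).

Let P1 : P setT = 1%E. Proof. exact: probability_setT. Qed.

Lemma cmap_chain n : cmap (Zt n).
Proof.
have [g gm gP] := cmap_id Z_countable Z_discrete.
exists (g \o Zt n) => [k|w w' /gP//].
rewrite comp_preimage -[X in measurable X]setTI.
exact: (measurable_funPT (Zt n)).
Qed.

Lemma cmap_level t : cmap (J t).
Proof.
exists (J t) => // k; rewrite -[X in measurable X]setTI.
exact: (measurable_funPT (J t)).
Qed.

(** The event that the first [n] states and [m] levels take given values. These
    events are the atoms on which conditional expectations are computed. *)
Definition history n m z j : set Om := path_event Zt n z `&` path_event J m j.

Lemma measurable_path_event (U : Type) (Y : nat -> Om -> U) n u :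
  (forall i, cmap (Y i)) -> measurable (path_event Y n u).
Proof.
move=> cY.
have -> : path_event Y n u =
    \bigcap_(i in [set i | (i < n)%N]) (Y i @^-1` [set u i]).
  by apply/seteqP; split=> w Yw i /= /Yw.
by apply: bigcap_measurableType => i _; exact: cmap_preimage.
Qed.

Lemma measurable_history n m z j : measurable (history n m z j).
Proof.
by apply: measurableI; apply: measurable_path_event;
  [exact: cmap_chain|exact: cmap_level].
Qed.

Lemma history_chainS n m z j s :
  history n.+1 m (upd z n s) j = history n m z j `&` (Zt n @^-1` [set s]).
Proof. by rewrite /history path_eventS setIAC. Qed.

Lemma history_levelS n m z j i :
  history n m.+1 z (upd j m i) = history n m z j `&` (J m @^-1` [set i]).
Proof. by rewrite /history path_eventS setIA. Qed.

(** The tower property: revealing [k] more states cuts a history into countably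
    many pieces, on each of which more of the integrand is constant. *)
Lemma le_integral_chain k n m z j (H1 H2 : Om -> R) :
  bounded_cmap H1 -> bounded_cmap H2 ->
  (forall z', (forall i, (i < n)%N -> z' i = z i) ->
    \int[P]_(w in history (n + k) m z' j) H1 w <=
    \int[P]_(w in history (n + k) m z' j) H2 w) ->
  \int[P]_(w in history n m z j) H1 w <= \int[P]_(w in history n m z j) H2 w.
Proof.
move=> b1 b2; elim: k n z => [|k IH] n z le12.
  by rewrite -[n]addn0; exact: le12.
apply: (le_integral_fibers P1 Z_countable (cmap_chain n)) => //.
  exact: measurable_history.
move=> s; rewrite -history_chainS; apply: IH => z' z'E.
rewrite addSnnS; apply: le12 => i lt_in.
by rewrite z'E ?upd_lt// ltnW.
Qed.

Lemma le_integral_level k n m z j (H1 H2 : Om -> R) :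
  bounded_cmap H1 -> bounded_cmap H2 ->
  (forall j', \int[P]_(w in history n (m + k) z j') H1 w <=
    \int[P]_(w in history n (m + k) z j') H2 w) ->
  \int[P]_(w in history n m z j) H1 w <= \int[P]_(w in history n m z j) H2 w.
Proof.
move=> b1 b2; elim: k m j => [|k IH] m j le12.
  by rewrite -[m]addn0; exact: le12.
apply: (le_integral_fibers P1 (countableP _) (cmap_level m)) => //.
  exact: measurable_history.
move=> s; rewrite -history_levelS; apply: IH => j'.
by rewrite addSnnS; exact: le12.
Qed.

Lemma prob_chainS n m z j :
  P (history n.+2 m z j) = (P (history n.+1 m z j) * K (z n) [set z n.+1])%E.
Proof. by rewrite /history !indep.2 chain.2 muleAC. Qed.

Definition mass n m z j : R := fine (P (history n m z j)).

Lemma mass_ge0 n m z j : 0 <= mass n m z j.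
Proof. exact: fine_ge0. Qed.

Lemma integral_history_cst n m z j (c : R) :
  \int[P]_(w in history n m z j) c = mass n m z j * c.
Proof. by rewrite mulrC Rintegral_cst//; exact: measurable_history. Qed.

Lemma mass_level n m z j i : (0 < i)%N ->
  mass n m.+1 z (upd j m i) = mass n m z j * 2^-1 ^+ i.
Proof.
move=> i0; rewrite /mass /history !indep.2 big_nat_recr//= muleA.
have -> : (\prod_(0 <= t < m) P [set w | J t w = upd j m i t] =
    \prod_(0 <= t < m) P [set w | J t w = j t])%E.
  by apply: eq_big_nat => t /andP[_ tm]; rewrite upd_lt.
rewrite upd_same -indep.2 indep.1// fineM//.
exact: (measure_fin P1 (measurable_history n m z j)).
Qed.

Lemma bounded_cmap_chain n phi : bounded phi -> bounded_cmap (phi \o Zt n).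
Proof.
by move=> [c Hc]; split; [exact: (cmap_comp _ (cmap_chain n))|exists c => w /=].
Qed.

(** The Markov property on point masses determines the conditional law of the
    next state, since a law on a countable space is tight. *)
Lemma markov_step n m z j phi : bounded phi ->
  \int[P]_(w in history n.+1 m z j) phi (Zt n.+1 w) =
  mass n.+1 m z j * transition K 1 phi (z n).
Proof.
move=> bphi; have mA := measurable_history n.+1 m z j.
have [P0|P_neq0] := eqVneq (mass n.+1 m z j) 0.
  have [c Hc] := bphi; rewrite P0 mul0r; apply/eqP; rewrite -normr_le0.
  have bZ := bounded_cmap_chain n.+1 bphi.
  apply: (le_trans (le_normr_Rintegral mA (bounded_cmap_integrable P1 mA bZ))).
  have -> : 0 = \int[P]_(w in history n.+1 m z j) c.
    by rewrite integral_history_cst P0 mul0r.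
  apply: (bounded_integral_le P1) => // [||w _]; last exact: Hc.
  - refine (bounded_cmap_chain n.+1 (phi := fun y => `|phi y|) _).
    by exists c => y; rewrite normr_id.
  - exact: bounded_cmap_cst.
pose E1 psi := (mass n.+1 m z j)^-1 *
  \int[P]_(w in history n.+1 m z j) psi (Zt n.+1 w).
suff E12 : E1 phi = transition K 1 phi (z n) by rewrite -E12 mulVKf.
apply: mean_eq (bphi).
- split=> [a f g b1 b2|f b0 f0|].
  + rewrite /E1 (bounded_integral_linear P1)//; try exact: bounded_cmap_chain.
    by rewrite mulrDr mulrCA.
  + by rewrite mulr_ge0 ?invr_ge0 ?mass_ge0// Rintegral_ge0.
  + by rewrite /E1 integral_history_cst mulr1 mulVf.
- exact: (transition_is_mean Z_countable Z_discrete K 1 (z n)).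
- exact: (integral_tight Z_countable Z_discrete (prob_kernel (z n))).
move=> a; rewrite /E1 /=.
apply: (mulfI P_neq0); rewrite mulVKf//.
rewrite (integral_pt Z_discrete).
have -> : mass n.+1 m z j * fine (K (z n) [set a]) =
    mass n.+2 m (upd z n.+1 a) j.
  have zE : history n.+1 m (upd z n.+1 a) j = history n.+1 m z j.
    by rewrite /history; congr (_ `&` _); apply/seteqP; split=> w Yw i lt_in;
      rewrite Yw// upd_lt.
  rewrite /mass prob_chainS upd_same upd_lt// zE fineM//.
    exact: (measure_fin P1).
  exact: (measure_fin (prob_kernel (z n))).
rewrite /mass history_chainS setIC -integral_indic//; last first.
  by apply: cmap_preimage; exact: cmap_chain.
congr fine; apply: eq_integral => w _; rewrite indicE /pt.
congr (nat_of_bool _)%:R%:E.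
by apply/eqP/idP => [?|/set_mem//]; exact: mem_set.
Qed.

Lemma markov n m z j k phi : bounded phi ->
  \int[P]_(w in history n.+1 m z j) phi (Zt (n + k)%N w) =
  mass n.+1 m z j * transition K k phi (z n).
Proof.
elim: k n z phi => [|k IH] n z phi bphi.
  rewrite addn0 -integral_history_cst.
  by apply: eq_Rintegral => w /set_mem[/(_ n)/= ->].
have btr := transition_bounded Z_countable Z_discrete K k bphi.
rewrite -addSnnS.
have -> : transition K k.+1 phi = transition K 1 (transition K k phi) by [].
rewrite -markov_step//.
apply: (eq_integral_fibers P1 Z_countable (cmap_chain n.+1)).
- exact: measurable_history.
- exact: bounded_cmap_chain.
- exact: bounded_cmap_chain.
move=> s; rewrite -history_chainS IH// -integral_history_cst.
by apply: eq_Rintegral => w /set_mem[/(_ n.+1)/= ->].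
Qed.

End History.

(** * Centred fields along the chain *)

Section SummableCorrelations.
Context {R : realType} {dZ : measure_display} {Z : measurableType dZ}.
Hypothesis Z_countable : countable [set: Z].
Hypothesis Z_discrete : forall z : Z, measurable [set z].
Context {nu : probability Z R} {K : R.-pker Z ~> Z}.
Hypothesis nu_inv : invariant_law K nu.
Context {b : nat}.
Hypothesis contraction : forall phi (M : R) z, 0 <= M ->
  (forall z, `|phi z| <= M) -> \int[nu]_z phi z = 0 ->
  `|transition K b phi z| <= M / 4.

(** Each block of [b] steps contributes at most a quarter of the previous one, so
    the correlations of the chain sum to a multiple of the mixing time. *)
Lemma sum_transition_le n phi (M : R) z : 0 <= M ->
  (forall z, `|phi z| <= M) -> \int[nu]_z phi z = 0 -> (0 < b)%N ->
  \sum_(0 <= i < n) `|transition K i phi z| <= 4 / 3 * b%:R * M.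
Proof.
move=> M0 phiM phi0 b0.
have [m] := ubnP n; elim: m => // m IH in n phi M M0 phiM phi0 *.
rewrite ltnS => nm.
have short k : \sum_(0 <= i < k) `|transition K i phi z| <= k%:R * M.
  apply: (@le_trans _ _ (\sum_(0 <= i < k) M)).
    by apply: ler_sum => i _; exact: transition_bound Z_countable Z_discrete _ _ _ _ phiM _.
  by rewrite sumr_const_nat subn0 mulr_natl.
have [nb|bn] := leqP n b.
  have := short n; have : n%:R * M <= b%:R * M by rewrite ler_wpM2r// ler_nat.
  have : 0 <= b%:R * M by rewrite mulr_ge0.
  lra.
rewrite (big_cat_nat _ (ltnW bn))//=.
have -> : \sum_(b <= i < n) `|transition K i phi z| =
    \sum_(0 <= i < n - b) `|transition K i (transition K b phi) z|.
  rewrite -{1}[b]add0n big_addn; apply: eq_bigr => i _.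
  by rewrite transitionD.
have := short b.
have : \sum_(0 <= i < n - b) `|transition K i (transition K b phi) z|
    <= 4 / 3 * b%:R * (M / 4).
  apply: IH; [by lra| | |by lia].
    by move=> y; exact: contraction.
  by rewrite (invariant_mean Z_countable Z_discrete)//; exists M.
lra.
Qed.

End SummableCorrelations.

Section CenteredFields.
Context {R : realType} {d : nat} {p : R}.
Hypothesis p_ge1 : 1 <= p.
Local Notation vec := 'rV[R]_d.
Local Notation nrm := (@pnorm R d p).
Context {dZ : measure_display} {Z : measurableType dZ}.
Hypothesis Z_countable : countable [set: Z].
Hypothesis Z_discrete : forall z : Z, measurable [set z].
Context {nu : probability Z R} {K : R.-pker Z ~> Z}.
Hypothesis nu_inv : invariant_law K nu.
Context {b : nat}.
Hypothesis contraction : forall phi (M : R) z, 0 <= M ->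
  (forall z, `|phi z| <= M) -> \int[nu]_z phi z = 0 ->
  `|transition K b phi z| <= M / 4.
Implicit Types (g : Z -> vec) (s : R).

Definition centered s g :=
  (forall z, dbound p s (g z)) /\ forall v, \int[nu]_z dot (g z) v = 0.

Definition vtransition t g (z : Z) : vec :=
  \row_i transition K t (fun y => g y 0 i) z.

Lemma bounded_dot s g v : (forall z, dbound p s (g z)) ->
  bounded (fun z => dot (g z) v).
Proof. by move=> gs; exists (s * nrm v) => z; exact: gs. Qed.

Lemma dot_vtransition s t g z v : (forall z, dbound p s (g z)) ->
  dot (vtransition t g z) v = transition K t (fun y => dot (g y) v) z.
Proof.
move=> gs; have mK := transition_is_mean Z_countable Z_discrete K t z.
have bg i : bounded (fun y => g y 0 i).
  have [c Hc] := bounded_dot (delta_mx 0 i) gs; exists c => y.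
  apply: le_trans (Hc y); rewrite /dot (bigD1 i)//= big1 => [|k ki].
    by rewrite mxE !eqxx mulr1 addr0.
  by rewrite mxE eqxx (negbTE ki) mulr0.
rewrite /dot.
under [in RHS]eq_fun do under eq_bigr do rewrite mulrC.
rewrite (mean_sum mK) => [|i]; last exact: boundedZ.
by apply: eq_bigr => i _; rewrite (meanZ mK)// mxE mulrC.
Qed.

Lemma centered0 s : 0 <= s -> centered s (fun=> 0).
Proof.
move=> s0; split=> [z|v]; first by apply: dboundW s0 _; exact: dbound0.
by under eq_Rintegral do rewrite dot0l; rewrite Rintegral_cst// mul0r.
Qed.

Lemma centeredZ a s g : centered s g -> centered (`|a| * s) (fun z => a *: g z).
Proof.
move=> [gs g0]; split=> [z|v]; first exact: dboundZ.
have mnu := integral_is_mean Z_countable Z_discrete (probability_setT nu).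
under eq_Rintegral do rewrite dotZl.
by rewrite (meanZ mnu) ?g0 ?mulr0//; exact: bounded_dot gs.
Qed.

Lemma centeredD s s' g g' : centered s g -> centered s' g' ->
  centered (s + s') (fun z => g z + g' z).
Proof.
move=> [gs g0] [gs' g0']; split=> [z|v]; first exact: dboundD.
have mnu := integral_is_mean Z_countable Z_discrete (probability_setT nu).
under eq_Rintegral do rewrite dotDl.
rewrite (meanD mnu) ?g0 ?g0' ?addr0//; exact: bounded_dot.
Qed.

Lemma centered_vtransition s g : 0 <= s -> centered s g ->
  centered (s / 4) (vtransition b g).
Proof.
move=> s0 [gs g0]; split=> [z v|v].
  rewrite (dot_vtransition _ _ _ gs) mulrAC.
  apply: contraction => //; first by rewrite mulr_ge0 ?pnorm_ge0.
  by move=> y; exact: gs.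
under eq_Rintegral do rewrite (dot_vtransition _ _ _ gs).
rewrite (invariant_mean Z_countable Z_discrete)//; exact: bounded_dot gs.
Qed.

(** Conditional expectation, given the current state, of the sum of the fields
    [gs] evaluated now, [b] steps later, [2 b] steps later, and so on. It is the
    Doob martingale of that sum, up to the part already revealed. *)
Fixpoint doob (gs : seq (Z -> vec)) : Z -> vec :=
  if gs is g :: gs' then fun z => g z + vtransition b (doob gs') z
  else fun=> 0.

(** The bound [4/3 s] solves [t = s + t/4]. *)
Lemma centered_doob s gs : 0 <= s ->
  (forall l, centered s (nth (fun=> 0) gs l)) -> centered (4 / 3 * s) (doob gs).
Proof.
move=> s0; elim: gs => [|g gs IH] gsP; first by apply: centered0; lra.
have -> : 4 / 3 * s = s + (4 / 3 * s) / 4 by lra.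
apply: centeredD; first exact: (gsP 0%N).
apply: centered_vtransition; first by lra.
by apply: IH => l; exact: (gsP l.+1).
Qed.

End CenteredFields.
Arguments centered {R d} p {dZ Z} nu s g.
Arguments vtransition {R d dZ Z} K t g z.
Arguments doob {R d dZ Z} K b gs z.

(** * Variance of batch means *)

Section BatchVariance.
Context {R : realType} {d : nat} {p : R}.
Hypothesis p_ge1 : 1 <= p.
Local Notation vec := 'rV[R]_d.
Local Notation nrm := (@pnorm R d p).
Context {X : set vec} {omega : vec -> \bar R} {domega : vec -> vec}.
Hypothesis X_compact : compact X.
Hypothesis X_convex : convex_set X.
Hypothesis omega_sc : strongly_convex1 nrm X omega.
Hypothesis omega_dg : distance_gradient X omega domega.
Local Notation conj := (@bconj R d X omega domega).
Context {dZ : measure_display} {Z : measurableType dZ}.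
Hypothesis Z_countable : countable [set: Z].
Hypothesis Z_discrete : forall z : Z, measurable [set z].
Context {nu : probability Z R} {K : R.-pker Z ~> Z}.
Hypothesis nu_inv : invariant_law K nu.
Context {b : nat}.
Hypothesis b_gt0 : (0 < b)%N.
Hypothesis contraction : forall phi (M : R) z, 0 <= M ->
  (forall z, `|phi z| <= M) -> \int[nu]_z phi z = 0 ->
  `|transition K b phi z| <= M / 4.
Context {dO : measure_display} {Om : measurableType dO} {P : probability Om R}.
Context {Zt : nat -> {RV P >-> Z}} {J : nat -> {RV P >-> nat}}.
Hypothesis chain : stationary_markov_chain K nu Zt.
Hypothesis indep : independent_geometric Zt J.
Implicit Types (z : nat -> Z) (j : nat -> nat) (g G : Z -> vec) (s : R).
Local Notation hist := (@history R dZ Z dO Om P Zt J).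
Local Notation mass := (@mass R dZ Z dO Om P Zt J).

Let P1 : P setT = 1%E. Proof. exact: probability_setT. Qed.

Lemma bounded_cmap_conj x (H : Om -> vec) a : X x -> cmap H ->
  (forall w, dbound p a (H w)) -> bounded_cmap (fun w => conj x (H w)).
Proof.
move=> Xx cH Ha; split; first exact: (cmap_comp (conj x) cH).
exists (2^-1 * a ^+ 2) => w.
rewrite ger0_norm; last exact: (bconj_ge0 p_ge1 X_compact).
exact: (bconj_le p_ge1 X_compact).
Qed.

Fixpoint path_sum n (gs : seq (Z -> vec)) (w : Om) : vec :=
  if gs is g :: gs' then g (Zt n w) + path_sum (n + b)%N gs' w else 0.

Lemma cmap_path_sum n gs : cmap (path_sum n gs).
Proof.
elim: gs n => [|g gs IH] n /=; first exact: cmap_cst.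
apply: cmap_comp2 => //.
exact: (cmap_comp g (cmap_chain Z_countable Z_discrete n)).
Qed.

Lemma dbound_path_sum s n gs w :
  (forall l y, dbound p s (nth (fun=> 0) gs l y)) ->
  dbound p ((size gs)%:R * s) (path_sum n gs w).
Proof.
elim: gs n => [|g gs IH] n gsP /=; first by rewrite mul0r; exact: dbound0.
rewrite -natr1 mulrDl mul1r addrC; apply: dboundD; first exact: (gsP 0%N).
by apply: IH => l; exact: (gsP l.+1).
Qed.

(** Increments of the Doob martingale are at most [5/3 s] in dual norm. The
    linear term of the smoothness inequality vanishes in conditional mean, so
    each increment costs only half its squared bound. *)
Lemma conj_path_sum_le s gs : 0 <= s ->
  (forall l, centered p nu s (nth (fun=> 0) gs l)) ->
  forall x n m z j (y : vec), X x ->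
  \int[P]_(w in hist n.+1 m z j) conj x (y + path_sum n gs w) <=
  mass n.+1 m z j * (conj x (y + doob K b gs (z n))
                     + (size gs)%:R * (2^-1 * (5 / 3 * s) ^+ 2)).
Proof.
move=> s0 gsP x n m z j y Xx.
have dbs gs' (gs'P : forall l, centered p nu s (nth (fun=> 0) gs' l)) v k :
    bounded_cmap (fun w => conj x (v + path_sum k gs' w)).
  have va := dual_norm_bound p_ge1 v.
  apply: (@bounded_cmap_conj _ _ (dual_norm nrm v + (size gs')%:R * s)) => //.
    exact: (cmap_comp (fun u => v + u) (cmap_path_sum k gs')).
  move=> w; apply: dboundD => //; apply: dbound_path_sum => l u.
  exact: (gs'P l).1.
elim: gs n z y gsP => [|g gs IH] n z y gsP /=.
  rewrite mul0r addr0 -integral_history_cst// !addr0.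
  exact: lexx.
have gsP' l : centered p nu s (nth (fun=> 0) gs l) by exact: (gsP l.+1).
have gP : centered p nu s g by exact: (gsP 0%N).
have dP := centered_doob Z_countable Z_discrete nu_inv contraction s0 gsP'.
set D := doob K b gs in dP *.
have s43 : 0 <= 4 / 3 * s by lra.
have [vDs _] := centered_vtransition Z_countable Z_discrete nu_inv contraction
  s43 dP.
set q := y + (g (z n) + vtransition K b D (z n)).
set y0 := prox X omega domega x (- q) - x.
set c := 2^-1 * (5 / 3 * s) ^+ 2.
pose H2 w := dot (D (Zt (n + b)%N w)) y0 +
  (conj x q - dot (vtransition K b D (z n)) y0 + c + (size gs)%:R * c).
have bD : bounded (fun u => dot (D u) y0) := bounded_dot y0 dP.1.
have b2 : bounded_cmap H2.
  apply: bounded_cmapD; last exact: bounded_cmap_cst.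
  exact: (bounded_cmap_chain Z_countable Z_discrete (n + b)%N bD).
have int2 : \int[P]_(w in hist n.+1 m z j) H2 w =
    mass n.+1 m z j * (conj x q + (size gs).+1%:R * c).
  rewrite /H2 RintegralD; last 3 first.
  - exact: measurable_history.
  - apply: (bounded_cmap_integrable P1); first exact: measurable_history.
    exact: (bounded_cmap_chain Z_countable Z_discrete (n + b)%N bD).
  - apply: (bounded_cmap_integrable P1); first exact: measurable_history.
    exact: bounded_cmap_cst.
  rewrite (markov Z_countable Z_discrete chain indep _ _ _ _ _ bD).
  rewrite integral_history_cst// -natr1.
  by rewrite -(dot_vtransition Z_countable Z_discrete _ _ _ dP.1); ring.
rewrite -int2.
apply: (le_integral_chain Z_countable Z_discrete (k := b)) => //.
  rewrite (_ : (fun w => _) = (fun w => conj x (y + path_sum n (g :: gs) w))) //.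
  exact: dbs.
move=> z' z'E; have zn : z' n = z n by exact: z'E.
set u := y + g (z n).
have -> : \int[P]_(w in hist (n.+1 + b) m z' j)
      conj x (y + (g (Zt n w) + path_sum (n + b)%N gs w)) =
    \int[P]_(w in hist (n.+1 + b) m z' j) conj x (u + path_sum (n + b)%N gs w).
  apply: eq_Rintegral => w /set_mem[/(_ n) Zn _].
  by rewrite addrA Zn ?zn// addSn ltnS leq_addr.
rewrite addSn; apply: (le_trans (IH _ _ _ gsP')).
have -> : \int[P]_(w in hist (n + b).+1 m z' j) H2 w =
    mass (n + b).+1 m z' j * (dot (D (z' (n + b)%N)) y0 +
      (conj x q - dot (vtransition K b D (z n)) y0 + c + (size gs)%:R * c)).
  rewrite -integral_history_cst//; apply: eq_Rintegral => w.
  by move=> /set_mem[/(_ (n + b)%N) Zn _]; rewrite /H2 Zn.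
apply: ler_wpM2l; first exact: mass_ge0.
have eta_b : dbound p (5 / 3 * s) (D (z' (n + b)%N) - vtransition K b D (z n)).
  have -> : 5 / 3 * s = 4 / 3 * s + 4 / 3 * s / 4 by lra.
  by apply: dboundD; [exact: dP.1|exact: dboundN].
have := bconj_smooth p_ge1 X_compact X_convex omega_sc omega_dg q Xx eta_b.
have -> : q + (D (z' (n + b)%N) - vtransition K b D (z n)) =
    u + D (z' (n + b)%N).
  by rewrite /q /u; apply/rowP => i; rewrite !mxE; ring.
rewrite dotBl -/y0 -/c; lra.
Qed.




Lemma path_sum_map n (h : nat -> Z -> vec) i r w :
  path_sum (n + b * i)%N [seq h l | l <- iota i r] w =
  \sum_(i <= l < i + r) h l (Zt (n + b * l)%N w).
Proof.
elim: r i => [|r IH] i /=; first by rewrite addn0 big_geq.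
rewrite -addnA -mulnSr IH addSnnS [RHS]big_ltn//.
by rewrite -[X in (X < _)%N]addn0 ltn_add2l.
Qed.

Lemma dbound_batch_mean s G (u : nat -> Z) n N : (0 < N)%N ->
  (forall y, dbound p s (G y)) -> dbound p s (batch_mean G u n N).
Proof.
move=> N0 Gs; rewrite /batch_mean.
have -> : s = `|N%:R^-1| * (\sum_(1 <= i < N.+1) s).
  rewrite sumr_const_nat subn1/= -[s *+ N]mulr_natl mulrA ger0_norm ?invr_ge0//.
  by rewrite mulVf ?mul1r// pnatr_eq0 -lt0n.
by apply: dboundZ; apply: dbound_sum => i _; exact: Gs.
Qed.

Lemma cmap_batch_mean G n N : cmap (fun w => batch_mean G (Zt ^~ w) n N).
Proof.
apply: (cmap_comp (fun v => N%:R^-1 *: v) (cmap_sum _ _ _)) => i.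
exact: (cmap_comp G (cmap_chain Z_countable Z_discrete _)).
Qed.

Lemma sum_residues (V : nmodType) (F : nat -> V) r :
  \sum_(0 <= i < b * r) F i = \sum_(k < b) \sum_(0 <= l < r) F (k + b * l)%N.
Proof.
elim: r => [|r IH].
  by rewrite muln0 big_geq// big1// => k _; rewrite big_geq.
rewrite mulnS addnC (big_cat_nat (leq0n (b * r)) (leq_addr b _))/= IH.
rewrite -{1}[(b * r)%N]add0n big_addn addKn big_mkord -big_split/=.
by apply: eq_bigr => k _; rewrite big_nat_recr.
Qed.

(** Averaging over the residues modulo [b] splits a batch into [b] sums along
    which the chain is contracting; convexity of the conjugate lets each be
    treated separately. This gives a variance proportional to [b / N], where
    martingale increments over single steps would only give [b^2 / N]. *)
Lemma conj_batch_mean_le s G (kappa : R) x n m z j N : 0 <= s ->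
  centered p nu s G -> X x -> (0 < N)%N ->
  \int[P]_(w in hist n.+1 m z j)
     conj x (kappa *: batch_mean G (Zt ^~ w) n N) <=
  mass n.+1 m z j * (9 / 2 * kappa ^+ 2 * s ^+ 2 * (b%:R / N%:R)).
Proof.
move=> s0 Gc Xx N0.
have NR : 0 < N%:R :> R by rewrite ltr0n.
have bR : 0 < b%:R :> R by rewrite ltr0n.
have bH : bounded_cmap (fun w => conj x (kappa *: batch_mean G (Zt ^~ w) n N)).
  apply: (@bounded_cmap_conj _ _ (`|kappa| * s)) => //.
    exact: (cmap_comp (fun v => kappa *: v) (cmap_batch_mean _ _ _)).
  by move=> w; apply: dboundZ; apply: dbound_batch_mean => //; exact: Gc.1.
have ks0 : 0 <= kappa ^+ 2 * s ^+ 2 by rewrite mulr_ge0 ?sqr_ge0.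
rewrite -integral_history_cst//.
(* A batch shorter than the mixing time is bounded without averaging. *)
have [Nb|bN] := ltnP N b.
  apply: (bounded_integral_le P1) => //.
  - exact: measurable_history.
  - exact: bounded_cmap_cst.
  move=> w _; apply: (@le_trans _ _ (2^-1 * (`|kappa| * s) ^+ 2)).
    apply: (bconj_le p_ge1 X_compact) => //; apply: dboundZ.
    by apply: dbound_batch_mean => //; exact: Gc.1.
  rewrite exprMn real_normK ?num_real//.
  have : 1 <= b%:R / N%:R :> R by rewrite ler_pdivlMr// mul1r ler_nat ltnW.
  by move/(ler_wpM2l ks0); lra.
set r := (N %/ b).+1.
have Nbr : (N <= b * r)%N by rewrite /r mulnC ltnW// ltn_ceil.
pose a := kappa * (b%:R / N%:R).
pose h k l : Z -> vec := if (k + b * l < N)%N then fun y => a *: G y else fun=> 0.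
pose gs k := [seq h k l | l <- iota 0 r].
have hc k l : centered p nu (`|a| * s) (h k l).
  rewrite /h; case: ifP => _; last by apply: centered0; rewrite mulr_ge0.
  exact: centeredZ.
have gsc k l : centered p nu (`|a| * s) (nth (fun=> 0) (gs k) l).
  have [lr|rl] := ltnP l r.
    by rewrite (nth_map 0%N) ?size_iota.
  by rewrite nth_default ?size_map ?size_iota//; apply: centered0; rewrite mulr_ge0.
have split w : kappa *: batch_mean G (Zt ^~ w) n N =
    b%:R^-1 *: \sum_(k < b) path_sum (n.+1 + k)%N (gs k) w.
  pose F i := if (i < N)%N then a *: G (Zt (n.+1 + i)%N w) else 0.
  have -> : \sum_(k < b) path_sum (n.+1 + k)%N (gs k) w =
      \sum_(0 <= i < b * r) F i.
    rewrite sum_residues; apply: eq_bigr => k _.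
    have := path_sum_map (n.+1 + k)%N (h k) 0 r w; rewrite muln0 addn0 add0n => ->.
    apply: eq_bigr => l _; rewrite /h /F addnA; by case: ifP.
  have tail0 : \sum_(N <= i < b * r) F i = 0.
    by rewrite big_nat big1// => i /andP[Ni _]; rewrite /F ltnNge Ni.
  rewrite (big_cat_nat (leq0n N) Nbr)/= tail0 addr0.
  rewrite /batch_mean big_add1/= scalerA !scaler_sumr big_nat [RHS]big_nat.
  apply: eq_bigr => i /andP[_ iN]; rewrite /F iN scalerA addSnnS; congr (_ *: _).
  by rewrite /a; field; rewrite !gt_eqF.
have bgs k : bounded_cmap (fun w => conj x (path_sum (n.+1 + k)%N (gs k) w)).
  apply: (@bounded_cmap_conj _ _ ((size (gs k))%:R * (`|a| * s))) => //.
    exact: cmap_path_sum.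
  by move=> w; apply: dbound_path_sum => l y; exact: (gsc k l).1.
apply: (@le_trans _ _ (\int[P]_(w in hist n.+1 m z j)
    (b%:R^-1 * \sum_(k < b) conj x (path_sum (n.+1 + k)%N (gs k) w)))).
  apply: (bounded_integral_le P1) => //.
  - exact: measurable_history.
  - by apply: bounded_cmapZ; exact: bounded_cmap_sum.
  move=> w _; rewrite split.
  exact: (bconj_mean p_ge1 X_compact X_convex omega_sc omega_dg
    (fun k => path_sum (n.+1 + k)%N (gs k) w)).
rewrite RintegralZl; last 2 first.
- exact: measurable_history.
- apply: (bounded_cmap_integrable P1); first exact: measurable_history.
  exact: bounded_cmap_sum.
rewrite (bounded_integral_sum P1); last 2 first.
- exact: measurable_history.
- by [].
pose c := 2^-1 * (4 / 3 * (`|a| * s)) ^+ 2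
  + r%:R * (2^-1 * (5 / 3 * (`|a| * s)) ^+ 2).
have as0 : 0 <= `|a| * s by rewrite mulr_ge0.
have each (k : 'I_b) : \int[P]_(w in hist n.+1 m z j)
    conj x (path_sum (n.+1 + k)%N (gs k) w) <= mass n.+1 m z j * c.
  rewrite -integral_history_cst//.
  apply: (le_integral_chain Z_countable Z_discrete (k := k.+1)) => //.
    exact: bounded_cmap_cst.
  move=> z' _; rewrite addnS integral_history_cst//.
  under eq_Rintegral do rewrite -[path_sum _ _ _]add0r.
  apply: (le_trans (conj_path_sum_le as0 (gsc k) _ _ _ _ _ Xx)).
  apply: ler_wpM2l; first exact: mass_ge0.
  rewrite /c size_map size_iota lerD2r add0r.
  apply: (bconj_le p_ge1 X_compact) => //.
  exact: (centered_doob Z_countable Z_discrete nu_inv contraction as0 (gsc k)).1.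
rewrite integral_history_cst//.
apply: (@le_trans _ _ (b%:R^-1 * \sum_(k < b) mass n.+1 m z j * c)).
  by rewrite ler_wpM2l ?invr_ge0// ler_sum.
rewrite sumr_const card_ord -[(mass _ _ _ _ * c) *+ b]mulr_natl mulKf ?gt_eqF//.
apply: ler_wpM2l; first exact: mass_ge0.
rewrite /c !exprMn real_normK ?num_real//.
have rle : r%:R + 1 <= 3 * (N%:R / b%:R) :> R.
  have : (N %/ b)%:R <= N%:R / b%:R :> R.
    by rewrite ler_pdivlMr// -natrM ler_nat leq_divM.
  have : 1 <= N%:R / b%:R :> R by rewrite ler_pdivlMr// mul1r ler_nat.
  rewrite /r -natr1; lra.
have aE : a ^+ 2 = kappa ^+ 2 * (b%:R / N%:R) ^+ 2 by rewrite /a exprMn.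
set q := b%:R / N%:R in aE *; have q0 : 0 < q by rewrite divr_gt0.
have rq : (r%:R + 1) * q <= 3.
  have : (r%:R + 1) * q <= 3 * (N%:R / b%:R) * q by rewrite ler_wpM2r// ltW.
  suff -> : 3 * (N%:R / b%:R) * q = 3 by [].
  by rewrite /q; field; rewrite !gt_eqF.
have e0 : 0 <= kappa ^+ 2 * s ^+ 2 * q by rewrite mulr_ge0// ltW.
have := ler_wpM2l e0 rq; rewrite aE.
have : 0 <= a ^+ 2 * s ^+ 2 by rewrite mulr_ge0 ?sqr_ge0.
rewrite aE; lra.
Qed.

End BatchVariance.

(** * The multilevel estimator *)

Section MultilevelDeterministic.
Context {R : realType} {d : nat} {p : R}.
Local Notation vec := 'rV[R]_d.
Context {Z : Type} {B M : nat}.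
Hypothesis B_gt0 : (0 < B)%N.
Hypothesis M_gt0 : (0 < M)%N.
Implicit Types (G : Z -> vec) (u : nat -> Z).

Let batch_gt0 i : (0 < 2 ^ i * B)%N. Proof. by rewrite muln_gt0 expn_gt0. Qed.

Lemma batch_meanB G (c : vec) u n N : (0 < N)%N ->
  batch_mean (fun y => G y - c) u n N = batch_mean G u n N - c.
Proof.
move=> N0; rewrite /batch_mean sumrB scalerBr; congr (_ - _).
rewrite sumr_const_nat subn1/= -[c *+ N]scaler_nat scalerA mulVf ?scale1r//.
by rewrite pnatr_eq0 -lt0n.
Qed.

Lemma mlmc_gradientB G (c : vec) u n j :
  mlmc_gradient (fun y => G y - c) u n B M j = mlmc_gradient G u n B M j - c.
Proof.
rewrite /mlmc_gradient !batch_meanB//; case: ifP => // _.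
by rewrite opprB addrA subrK addrAC.
Qed.

Lemma eq_batch_mean G u u' n N :
  (forall i, (i <= N)%N -> u (n + i)%N = u' (n + i)%N) ->
  batch_mean G u n N = batch_mean G u' n N.
Proof.
move=> uu'; rewrite /batch_mean; congr (_ *: _); apply: eq_big_nat => i.
by rewrite ltnS => /andP[_ iN]; rewrite uu'.
Qed.

Lemma eq_mlmc_gradient G u u' n j :
  (forall i, (i <= 2 ^ j * B)%N -> u (n + i)%N = u' (n + i)%N) ->
  mlmc_gradient G u n B M j = mlmc_gradient G u' n B M j.
Proof.
move=> uu'; rewrite /mlmc_gradient.
have e k : (k <= j)%N -> batch_mean G u n (2 ^ k * B) =
    batch_mean G u' n (2 ^ k * B).
  move=> kj; apply: eq_batch_mean => i ik; apply: uu'.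
  by rewrite (leq_trans ik)// leq_pmul2r// leq_pexp2l.
by rewrite !e ?leq_pred.
Qed.

(** The estimator, written as a sum over all levels with a single active one:
    this separates the level from the states. *)
Lemma mlmc_gradient_levels G u n j :
  mlmc_gradient G u n B M j = batch_mean G u n (2 ^ 0 * B) +
  \sum_(1 <= l < (trunc_log 2 M).+1) (j == l)%:R *:
    (2 ^+ l *: (batch_mean G u n (2 ^ l * B) - batch_mean G u n (2 ^ l.-1 * B))).
Proof.
rewrite /mlmc_gradient.
have -> : (2 ^ j <= M)%N = (j <= trunc_log 2 M)%N.
  apply/idP/idP => [|jm]; first exact: trunc_log_max.
  by apply: leq_trans (trunc_logP (isT : (1 < 2)%N) M_gt0); rewrite leq_pexp2l.
have [jm|mj] := leqP j (trunc_log 2 M); last first.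
  rewrite big_nat big1 ?addr0// => l /andP[_]; rewrite ltnS => lm.
  by rewrite gtn_eqF ?scale0r// (leq_ltn_trans lm).
congr (_ + _); case: j jm => [|j] jm.
  rewrite subrr scaler0 big_nat big1// => l /andP[l0 _].
  by rewrite ltn_eqF ?scale0r.
rewrite (bigD1_seq j.+1) ?iota_uniq ?mem_index_iota//=.
rewrite eqxx scale1r big1 ?addr0// => l lj.
by rewrite eq_sym (negbTE lj) scale0r.
Qed.

Lemma dbound_mlmc_gradient (s : R) G u n j : 0 <= s ->
  (forall N, (0 < N)%N -> dbound p s (batch_mean G u n N)) ->
  dbound p (s * (1 + 2 * M%:R)) (mlmc_gradient G u n B M j).
Proof.
move=> s0 Gs; rewrite /mlmc_gradient; case: ifP => jM; last first.
  apply: dboundW (Gs _ (batch_gt0 0)).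
  by rewrite ler_peMr// lerDl mulr_ge0.
rewrite mulrDr mulr1; apply: dboundD; first exact: Gs.
apply: (@dboundW _ _ _ (`|2 ^+ j| * (s + s))).
  have /(ler_wpM2l s0) : 2 ^+ j <= M%:R :> R by rewrite -natrX ler_nat.
  rewrite ger0_norm ?exprn_ge0//; lra.
by apply: dboundZ; apply: dboundD; [exact: Gs|apply: dboundN; exact: Gs].
Qed.

End MultilevelDeterministic.

Lemma cmap_mlmc_gradient (R : realType) (d : nat) (Z : Type)
    (dT : measure_display) (T : measurableType dT) (u : nat -> T -> Z)
    (G : T -> Z -> 'rV[R]_d) (N j : T -> nat) B M :
  (forall n k, cmap (fun w => batch_mean (G w) (u ^~ w) n k)) ->
  cmap N -> cmap j ->
  cmap (fun w => mlmc_gradient (G w) (u ^~ w) (N w) B M (j w)).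
Proof.
move=> cb cN cj.
apply: (cmap_bind
  (H := fun n w => mlmc_gradient (G w) (u ^~ w) n B M (j w)) cN) => n.
apply: (cmap_bind
  (H := fun i w => mlmc_gradient (G w) (u ^~ w) n B M i) cj) => i.
rewrite /mlmc_gradient; case: (2 ^ i <= M)%N; last exact: cb.
apply: (cmap_comp2 (fun v v' => v + 2 ^+ i *: v')); first exact: cb.
by apply: (cmap_comp2 (fun v v' => v - v')); exact: cb.
Qed.

Section Multilevel.
Context {R : realType} {d : nat} {p : R}.
Hypothesis p_ge1 : 1 <= p.
Local Notation vec := 'rV[R]_d.
Local Notation nrm := (@pnorm R d p).
Context {X : set vec} {omega : vec -> \bar R} {domega : vec -> vec}.
Hypothesis X_compact : compact X.
Hypothesis X_convex : convex_set X.
Hypothesis omega_sc : strongly_convex1 nrm X omega.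
Hypothesis omega_dg : distance_gradient X omega domega.
Local Notation conj := (bconj X omega domega).
Context {dZ : measure_display} {Z : measurableType dZ}.
Hypothesis Z_countable : countable [set: Z].
Hypothesis Z_discrete : forall z : Z, measurable [set z].
Context {nu : probability Z R} {K : R.-pker Z ~> Z}.
Hypothesis nu_inv : invariant_law K nu.
Context {b : nat}.
Hypothesis b_gt0 : (0 < b)%N.
Hypothesis contraction : forall phi (M : R) z, 0 <= M ->
  (forall z, `|phi z| <= M) -> \int[nu]_z phi z = 0 ->
  `|transition K b phi z| <= M / 4.
Context {dO : measure_display} {Om : measurableType dO} {P : probability Om R}.
Context {Zt : nat -> {RV P >-> Z}} {J : nat -> {RV P >-> nat}}.
Hypothesis chain : stationary_markov_chain K nu Zt.
Hypothesis indep : independent_geometric Zt J.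
Context {B M : nat}.
Hypothesis B_gt0 : (0 < B)%N.
Hypothesis M_gt1 : (1 < M)%N.
Context {s : R} {G : Z -> vec}.
Hypothesis s_ge0 : 0 <= s.
Hypothesis G_centered : centered p nu s G.
Implicit Types (z : nat -> Z) (j : nat -> nat) (v : vec).
Local Notation hist := (@history R dZ Z dO Om P Zt J).
Local Notation mass := (@mass R dZ Z dO Om P Zt J).
Local Notation lvl := (trunc_log 2 M).

Let P1 : P setT = 1%E. Proof. exact: probability_setT. Qed.
Let M_gt0 : (0 < M)%N. Proof. exact: ltnW. Qed.
Let batch_gt0 i : (0 < 2 ^ i * B)%N. Proof. by rewrite muln_gt0 expn_gt0 B_gt0. Qed.

(** Conditional mean, given the current state [y], of [dot g v] for the mean [g] of
    [G] over the next [N] states. *)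
Definition mean_bias N (y : Z) v : R :=
  N%:R^-1 * \sum_(1 <= i < N.+1) transition K i (fun y => dot (G y) v) y.

Lemma bounded_cmap_dot_batch n N v :
  bounded_cmap (fun w => dot (batch_mean G (Zt ^~ w) n N) v).
Proof.
split; first exact: (cmap_comp (dot^~ v) (cmap_batch_mean _ _ _ _ _)).
have [->|N0] := posnP N.
  by exists 0 => w; rewrite /batch_mean invr0 scale0r dot0l normr0.
exists (s * nrm v) => w.
exact: (dbound_batch_mean _ _ N0 G_centered.1).
Qed.

Lemma integral_dot_batch n m z j N v :
  \int[P]_(w in hist n.+1 m z j) dot (batch_mean G (Zt ^~ w) n N) v =
  mass n.+1 m z j * mean_bias N (z n) v.
Proof.
have bG := bounded_dot v G_centered.1.
have mH := measurable_history Z_countable Z_discrete n.+1 m z j.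
under eq_Rintegral do rewrite dotZl dot_suml.
have bZ i : bounded_cmap (fun w => dot (G (Zt (n + i)%N w)) v).
  exact: (bounded_cmap_chain Z_countable Z_discrete (n + i)%N bG).
rewrite RintegralZl//; last first.
  by apply: (bounded_cmap_integrable P1) => //; exact: bounded_cmap_sum.
rewrite (bounded_integral_sum P1)// mulrCA; congr (_ * _).
rewrite mulr_sumr; apply: eq_bigr => i _.
exact: (markov Z_countable Z_discrete chain indep _ _ _ _ _ bG).
Qed.

Lemma mean_bias_le N y v : (0 < N)%N ->
  `|mean_bias N y v| <= s * nrm v /\
  `|mean_bias N y v| <= 4 / 3 * b%:R / N%:R * (s * nrm v).
Proof.
move=> N0; have NR : 0 < N%:R :> R by rewrite ltr0n.
set phi := fun y => dot (G y) v.
have phis u : `|phi u| <= s * nrm v by exact: G_centered.1.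
have snv : 0 <= s * nrm v by rewrite mulr_ge0 ?pnorm_ge0.
have le_sum : `|mean_bias N y v| <=
    N%:R^-1 * \sum_(1 <= i < N.+1) `|transition K i phi y|.
  rewrite normrM ger0_norm ?invr_ge0// ler_wpM2l ?invr_ge0//.
  exact: ler_norm_sum.
split; apply: (le_trans le_sum); rewrite mulrC ler_pdivrMr//.
  apply: (@le_trans _ _ (\sum_(1 <= i < N.+1) (s * nrm v))).
    by apply: ler_sum => i _; exact: transition_bound.
  by rewrite sumr_const_nat subn1 mulr_natr.
have -> : 4 / 3 * b%:R / N%:R * (s * nrm v) * N%:R =
    4 / 3 * b%:R * (s * nrm v) by field; rewrite gt_eqF.
have := sum_transition_le Z_countable Z_discrete nu_inv contraction N.+1 y
  snv phis (G_centered.2 v) b_gt0.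
by apply: le_trans; rewrite [X in _ <= X]big_ltn// lerDr.
Qed.

Lemma integral_level n t z j l (H : Om -> R) :
  \int[P]_(w in hist n.+1 t z j) ((J t w == l)%:R * H w) =
  \int[P]_(w in hist n.+1 t.+1 z (upd j t l)) H w.
Proof.
rewrite history_levelS Rintegral_mkcondr; apply: eq_Rintegral => w _.
rewrite patchE.
have -> : (w \in J t @^-1` [set l]) = (J t w == l).
  by apply/idP/eqP => [/set_mem//|?]; exact: mem_set.
by case: eqP; rewrite ?mul1r ?mul0r.
Qed.

Lemma cmap_level_eq t l : bounded_cmap (fun w => (J t w == l)%:R : R).
Proof.
split; first exact: (cmap_comp (fun i => (i == l)%:R) (cmap_level t)).
by exists 1 => w; case: eqP; rewrite ?normr1 ?normr0.
Qed.

(** The geometric weights make the levels telescope: in conditional mean the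
    estimator is the batch mean of the highest level. *)
Lemma integral_dot_mlmc n t z j v :
  \int[P]_(w in hist n.+1 t z j)
    dot (mlmc_gradient G (Zt ^~ w) n B M (J t w)) v =
  mass n.+1 t z j * mean_bias (2 ^ lvl * B) (z n) v.
Proof.
have mH := measurable_history Z_countable Z_discrete n.+1 t z j.
pose e i w := dot (batch_mean G (Zt ^~ w) n (2 ^ i * B)) v.
have be i : bounded_cmap (e i) by exact: bounded_cmap_dot_batch.
have Ie m j' i : \int[P]_(w in hist n.+1 m z j') e i w =
    mass n.+1 m z j' * mean_bias (2 ^ i * B) (z n) v.
  exact: integral_dot_batch.
have bd l : bounded_cmap (fun w => 2 ^+ l * (e l w + -1 * e l.-1 w)).
  by apply/bounded_cmapZ/bounded_cmapD => //; exact: bounded_cmapZ.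
have bl l : bounded_cmap (fun w => (J t w == l)%:R *
    (2 ^+ l * (e l w + -1 * e l.-1 w))).
  by apply: bounded_cmapM => //; exact: cmap_level_eq.
transitivity (\int[P]_(w in hist n.+1 t z j) (e 0%N w +
    \sum_(1 <= l < lvl.+1) (J t w == l)%:R *
      (2 ^+ l * (e l w + -1 * e l.-1 w)))).
  apply: eq_Rintegral => w _; rewrite mlmc_gradient_levels// dotDl dot_suml.
  congr (_ + _); apply: eq_bigr => l _.
  by rewrite !dotZl dotBl mulN1r.
rewrite RintegralD//; last 2 first.
- exact: (bounded_cmap_integrable P1).
- by apply: (bounded_cmap_integrable P1) => //; exact: bounded_cmap_sum.
rewrite [X in _ + X](bounded_integral_sum P1)// Ie.
have -> : \sum_(1 <= l < lvl.+1) \int[P]_(w in hist n.+1 t z j)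
      ((J t w == l)%:R * (2 ^+ l * (e l w + -1 * e l.-1 w))) =
    \sum_(1 <= l < lvl.+1) mass n.+1 t z j *
      (mean_bias (2 ^ l * B) (z n) v - mean_bias (2 ^ l.-1 * B) (z n) v).
  apply: eq_big_nat => l /andP[l0 _]; rewrite integral_level.
  have mH' := measurable_history Z_countable Z_discrete n.+1 t.+1 z (upd j t l).
  rewrite RintegralZl//; last first.
    apply: (bounded_cmap_integrable P1) => //.
    by apply: bounded_cmapD => //; exact: bounded_cmapZ.
  rewrite RintegralD//; last 2 first.
  - exact: (bounded_cmap_integrable P1).
  - by apply: (bounded_cmap_integrable P1) => //; exact: bounded_cmapZ.
  rewrite RintegralZl//; last exact: (bounded_cmap_integrable P1).
  rewrite !Ie (mass_level Z_countable Z_discrete indep)//.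
  rewrite exprVn mulN1r -mulrBr !mulrA; congr (_ * _).
  by rewrite mulrAC mulfV ?mul1r// expf_neq0.
rewrite -mulr_sumr -mulrDr; congr (_ * _).
rewrite big_add1/= (telescope_sumr (fun l => mean_bias (2 ^ l * B) (z n) v))//.
by rewrite addrC subrK.
Qed.

(** At level [l] the factor [4^l] of the squared weight is compensated by the
    probability [2^-l] of the level and by the batch size [2^l B], so every
    level contributes equally: 54 units for each level, and 9 for the base batch,
    which is charged to the first level. *)
Lemma conj_mlmc_le x kappa n t z j : X x ->
  \int[P]_(w in hist n.+1 t z j)
    conj x (kappa *: mlmc_gradient G (Zt ^~ w) n B M (J t w)) <=
  mass n.+1 t z j *
    (63 * lvl%:R * (kappa ^+ 2 * s ^+ 2 * (b%:R / B%:R))).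
Proof.
move=> Xx.
have mH := measurable_history Z_countable Z_discrete n.+1 t z j.
pose e i w := batch_mean G (Zt ^~ w) n (2 ^ i * B).
have ce i : cmap (e i) by exact: cmap_batch_mean.
have de i w : dbound p s (e i w).
  by apply: dbound_batch_mean => //; exact: G_centered.1.
have bc k i : bounded_cmap (fun w => conj x (k *: e i w)).
  apply: (@bounded_cmap_conj _ _ _ p_ge1 _ _ _ X_compact X_convex omega_sc
    omega_dg _ _ _ _ (`|k| * s)) => //.
    exact: (cmap_comp (fun v => k *: v) (ce i)).
  by move=> w; exact: dboundZ.
pose Hl l w := 2^-1 * (conj x (4 * kappa * 2 ^+ l *: e l w) +
  conj x (- (4 * kappa * 2 ^+ l) *: e l.-1 w)).
have bHl l : bounded_cmap (Hl l) by apply/bounded_cmapZ/bounded_cmapD.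
pose H w := 2^-1 * (conj x (2 * kappa *: e 0%N w) +
  \sum_(1 <= l < lvl.+1) (J t w == l)%:R * Hl l w).
have bS : bounded_cmap
    (fun w => \sum_(1 <= l < lvl.+1) (J t w == l)%:R * Hl l w).
  apply: bounded_cmap_sum => l; apply: bounded_cmapM => //.
  exact: cmap_level_eq.
have bH : bounded_cmap H by apply/bounded_cmapZ/bounded_cmapD.
have le_H w : conj x (kappa *: mlmc_gradient G (Zt ^~ w) n B M (J t w)) <= H w.
  rewrite mlmc_gradient_levels// scalerDr.
  apply: (le_trans (bconjD p_ge1 X_compact X_convex omega_sc omega_dg _ _ Xx)).
  rewrite ![2 *: _]scalerA /H ler_pM2l ?invr_gt0// lerD2l.
  have [/andP[J1 JM]|Jout] := boolP (0 < J t w < lvl.+1)%N; last first.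
    rewrite big_nat big1 ?scaler0 ?(bconj0 p_ge1)// => [|l lb]; last first.
      by case: eqP lb Jout => [->->//|_ _ _]; rewrite scale0r.
    apply: sumr_ge0 => l _; rewrite mulr_ge0// /Hl mulr_ge0 ?invr_ge0//.
    by rewrite addr_ge0// (bconj_ge0 p_ge1 X_compact).
  rewrite (bigD1_seq (J t w)) ?iota_uniq ?mem_index_iota ?J1//=.
  rewrite big1 => [|l lJ]; last by rewrite eq_sym (negbTE lJ) scale0r.
  rewrite [leRHS](bigD1_seq (J t w)) ?iota_uniq ?mem_index_iota ?J1//=.
  rewrite [X in _ <= _ + X]big1 => [|l lJ]; last first.
    by rewrite eq_sym (negbTE lJ) mul0r.
  rewrite !addr0 eqxx scale1r mul1r scalerA scalerBr -scaleNr.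
  apply: (le_trans (bconjD p_ge1 X_compact X_convex omega_sc omega_dg _ _ Xx)).
  rewrite /Hl !scalerA.
  have -> : 2 * (2 * kappa * 2 ^+ J t w) = 4 * kappa * 2 ^+ J t w by ring.
  by have -> : 2 * - (2 * kappa * 2 ^+ J t w) = - (4 * kappa * 2 ^+ J t w) by ring.
apply: (@le_trans _ _ (\int[P]_(w in hist n.+1 t z j) H w)).
  apply: (bounded_integral_le P1) => //.
  apply: (@bounded_cmap_conj _ _ _ p_ge1 _ _ _ X_compact X_convex omega_sc
    omega_dg _ _ _ _ (`|kappa| * (s * (1 + 2 * M%:R)))) => //; last first.
    by move=> w; apply: dboundZ; apply: dbound_mlmc_gradient => // N N0;
      apply: dbound_batch_mean => //; exact: G_centered.1.
  apply: (cmap_comp (fun v => kappa *: v)).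
  apply: (cmap_mlmc_gradient (G := fun=> G) (N := fun=> n) (j := J t)).
  - by move=> k N; exact: cmap_batch_mean.
  - exact: cmap_cst.
  - exact: cmap_level.
set q := kappa ^+ 2 * s ^+ 2 * (b%:R / B%:R).
have q0 : 0 <= q by rewrite mulr_ge0 ?divr_ge0// mulr_ge0 ?sqr_ge0.
have int_e m j' k i : \int[P]_(w in hist n.+1 m z j') conj x (k *: e i w) <=
    mass n.+1 m z j' * (9 / 2 * k ^+ 2 * s ^+ 2 * (b%:R / (2 ^ i * B)%:R)).
  by apply: (conj_batch_mean_le p_ge1 X_compact X_convex omega_sc omega_dg
    Z_countable Z_discrete nu_inv b_gt0 contraction chain indep).
have int_l l : (0 < l)%N -> \int[P]_(w in hist n.+1 t z j)
    ((J t w == l)%:R * Hl l w) <= mass n.+1 t z j * (108 * q).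
  move=> l0; rewrite integral_level /Hl.
  have mH' := measurable_history Z_countable Z_discrete n.+1 t.+1 z (upd j t l).
  rewrite RintegralZl//; last first.
    by apply: (bounded_cmap_integrable P1) => //; exact: bounded_cmapD.
  rewrite RintegralD//; try exact: (bounded_cmap_integrable P1).
  have := int_e t.+1 (upd j t l) (4 * kappa * 2 ^+ l) l.
  have := int_e t.+1 (upd j t l) (- (4 * kappa * 2 ^+ l)) l.-1.
  rewrite (mass_level Z_countable Z_discrete indep)//.
  rewrite !natrM !natrX exprVn; have lE : 2 ^+ l = 2 * 2 ^+ l.-1 :> R.
    by rewrite -exprS prednK.
  set r := 2 ^+ l.-1 in lE *; have r0 : 0 < r by rewrite exprn_gt0.
  have half0 : 0 <= 2^-1 :> R by rewrite invr_ge0.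
  rewrite lE => le1 le2; apply: (le_trans (ler_wpM2l half0 (lerD le2 le1))).
  rewrite le_eqVlt; apply/orP; left; apply/eqP; rewrite /q; field.
  by rewrite !gt_eqF// ltr0n.
apply: (@le_trans _ _ (2^-1 * (mass n.+1 t z j * (18 * q) +
    \sum_(1 <= l < lvl.+1) mass n.+1 t z j * (108 * q)))).
  rewrite /H RintegralZl//; last first.
    by apply: (bounded_cmap_integrable P1) => //; exact: bounded_cmapD.
  rewrite ler_pM2l ?invr_gt0// RintegralD//; try exact: (bounded_cmap_integrable P1).
  rewrite (bounded_integral_sum P1)//; last first.
    by move=> l; apply: bounded_cmapM => //; exact: cmap_level_eq.
  apply: lerD.
    have := int_e t j (2 * kappa) 0%N; rewrite expn0 mul1n.
    have -> : 9 / 2 * (2 * kappa) ^+ 2 * s ^+ 2 * (b%:R / B%:R) = 18 * q.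
      by rewrite /q; field; rewrite gt_eqF// ltr0n.
    exact.
  rewrite big_nat [leRHS]big_nat; apply: ler_sum => l /andP[l0 _].
  exact: int_l.
rewrite sumr_const_nat subn1/= -[_ *+ lvl]mulr_natl.
have m0 : 0 <= mass n.+1 t z j * q by rewrite mulr_ge0 ?mass_ge0.
have lvl1 : 1 <= lvl%:R :> R by rewrite ler1n trunc_log_gt0.
have := ler_wpM2l m0 lvl1; lra.
Qed.

End Multilevel.

(** * The gradient error of the algorithm *)

Lemma centered_gradient (R : realType) (d : nat) (p : R)
    (dZ : measure_display) (Z : measurableType dZ) (nu : probability Z R)
    (g : Z -> 'rV[R]_d) (c : 'rV[R]_d) (sigma : R) :
  1 <= p -> countable [set: Z] -> (forall z : Z, measurable [set z]) ->
  has_vmean nu g c ->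
  (forall z, dual_norm (pnorm p) (g z - c) ^+ 2 <= sigma ^+ 2) ->
  centered p nu `|sigma| (fun z => g z - c).
Proof.
move=> p1 Zc Zd gc gs.
have gb z : dbound p `|sigma| (g z - c).
  apply: dboundW (dual_norm_bound p1 _).
  apply: (le_trans (ler_norm _)).
  rewrite -(@ler_pXn2r _ 2)// ?nnegrE//.
  by rewrite !real_normK ?num_real.
split=> // v; have mnu := integral_is_mean Zc Zd (probability_setT nu).
have bi i : bounded (fun z => (g z - c) 0 i).
  exists `|sigma * pnorm p (delta_mx 0 i : 'rV[R]_d)| => z.
  have := gb z (delta_mx 0 i); rewrite normrM (ger0_norm (pnorm_ge0 _)).
  apply: le_trans.
  rewrite /dot (bigD1 i)//= big1 => [|k ki].
    by rewrite !mxE !eqxx mulr1 addr0.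
  by rewrite [delta_mx _ _ _ _]mxE eqxx (negbTE ki) mulr0.
have gi i : bounded (fun z => g z 0 i).
  have := boundedD (bi i) (bounded_cst (c 0 i)).
  by under eq_fun do rewrite !mxE subrK.
have mean_i i : \int[nu]_z (g z - c) 0 i = 0.
  under eq_Rintegral do rewrite mxE.
  rewrite (meanD mnu)//; last exact: bounded_cst.
  rewrite (mean_cst mnu) mxE.
  have [_ mi] := gc i; move: mi; rewrite unlock => mi.
  by rewrite /Rintegral mi subrr.
rewrite /dot; under eq_Rintegral do under eq_bigr do rewrite mulrC.
rewrite (mean_sum mnu) => [|i]; last exact: boundedZ.
by apply: big1 => i _; rewrite (meanZ mnu)// mean_i mulr0.
Qed.

Lemma am_gm (R : realType) (h a y T : R) :
  0 < T -> 0 <= a -> 0 <= y -> h ^+ 2 <= a * y -> h <= a / (2 * T) + T * y / 2.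
Proof.
move=> T0 a0 y0 hay; have r0 : 0 <= a / (2 * T) + T * y / 2.
  by rewrite addr_ge0 ?divr_ge0 ?mulr_ge0// ltW.
apply: (le_trans (ler_norm h)); rewrite -(@ler_pXn2r _ 2)// ?nnegrE//.
rewrite real_normK ?num_real//; apply: (le_trans hay).
have := sqr_ge0 (a / (2 * T) - T * y / 2).
have -> : (a / (2 * T) - T * y / 2) ^+ 2 =
    (a / (2 * T) + T * y / 2) ^+ 2 - a * y by field; rewrite gt_eqF.
by rewrite subr_ge0.
Qed.

Lemma ln2_ge_half (R : realType) : 2^-1 <= ln 2 :> R.
Proof.
have half : -1 < 2^-1 - 1 :> R by rewrite ltrBrDl subrr invr_gt0.
have := le_ln1Dx half; rewrite addrC subrK lnV ?posrE//.
lra.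
Qed.

Lemma ln_nat_ge0 (R : realType) n : 0 <= ln n%:R :> R.
Proof. by case: n => [|n]; [rewrite ln0|rewrite ln_ge0// ler1n]. Qed.

Lemma trunc_log_le_ln (R : realType) (M : nat) : (0 < M)%N ->
  (trunc_log 2 M)%:R <= 2 * ln M%:R :> R.
Proof.
move=> M0; have MR : 0 < M%:R :> R by rewrite ltr0n.
have : ln (2 ^+ trunc_log 2 M) <= ln M%:R :> R.
  rewrite ler_ln ?posrE ?exprn_gt0// -natrX ler_nat.
  exact: trunc_logP.
rewrite lnXn// -[ln 2 *+ _]mulr_natl.
have := ler_wpM2l (ler0n R (trunc_log 2 M)) (ln2_ge_half R); lra.
Qed.

Section Iterates.
Context {R : realType} {d : nat} {p : R}.
Hypothesis p_ge1 : 1 <= p.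
Local Notation vec := 'rV[R]_d.
Context {X : set vec} {omega : vec -> \bar R} {domega : vec -> vec}.
Hypothesis X_convex : convex_set X.
Hypothesis omega_sc : strongly_convex1 (pnorm p) X omega.
Hypothesis omega_dg : distance_gradient X omega domega.
Context {dZ : measure_display} {Z : measurableType dZ}.
Hypothesis Z_countable : countable [set: Z].
Hypothesis Z_discrete : forall z : Z, measurable [set z].
Context {dO : measure_display} {Om : measurableType dO} {P : probability Om R}.
Context {Zt : nat -> {RV P >-> Z}} {J : nat -> {RV P >-> nat}}.
Context {gradF : vec -> Z -> vec} {gamma beta : nat -> R} {B M : nat}.
Hypothesis B_gt0 : (0 < B)%N.
Context {x xg xf : nat -> Om -> vec} {N : nat -> Om -> nat}.
Hypothesis mamd : batched_mamd X (bregman omega domega) gradF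
  (fun t => Zt t) (fun t => J t) gamma beta B M x xg xf N.
Hypothesis x_mem : forall t w, X (x t w).

Let xS t w w' :
  x t w = x t w' ->
  mlmc_gradient (gradF (xg t w)) (Zt ^~ w) (N t w) B M (J t w) =
  mlmc_gradient (gradF (xg t w')) (Zt ^~ w') (N t w') B M (J t w') ->
  x t.+1 w = x t.+1 w'.
Proof.
move=> xx gg; have := mamd_x mamd t w'; rewrite -xx -gg => px'.
exact: (is_prox_uniq p_ge1 X_convex omega_sc omega_dg (x_mem t w)
  (mamd_x mamd t w) px').
Qed.

Lemma cmap_offset t : cmap (N t).
Proof.
elim: t => [|t IH].
  apply: (cmap_factor (cmap_cst tt)) => w w' _.
  by rewrite !(mamd_N0 mamd).
apply: (cmap_factor (cmap_pair IH (cmap_level (J := J) t))) => w w' [e1 e2].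
by rewrite !(mamd_N mamd) e1 e2.
Qed.

Lemma cmap_iterates t :
  cmap (fun w => (x t w, xf t w)) /\ cmap (fun w => xg t w).
Proof.
suff c : cmap (fun w => (x t w, xf t w)).
  by split=> //; apply: (cmap_factor c) => w w' [e1 e2]; rewrite !(mamd_xg mamd) e1 e2.
elim: t => [|t IH].
  apply: (cmap_factor (cmap_cst tt)) => w w' _.
  by have [x0 _ x0P] := mamd_init mamd; rewrite !(x0P _).1 !(x0P _).2.
have cg : cmap (xg t).
  by apply: (cmap_factor IH) => w w' [e1 e2]; rewrite !(mamd_xg mamd) e1 e2.
have cm : cmap (fun w =>
    mlmc_gradient (gradF (xg t w)) (Zt ^~ w) (N t w) B M (J t w)).
  apply: cmap_mlmc_gradient; [|exact: cmap_offset|exact: cmap_level].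
  move=> n k; apply: (cmap_comp (fun v => k%:R^-1 *: v)).
  apply: cmap_sum => i; apply: cmap_comp2; first exact: cg.
  exact: cmap_chain.
apply: (cmap_factor (cmap_pair IH cm)) => w w' [e1 e2 e3].
by rewrite !(mamd_xf mamd) (xS e1 e3) e2.
Qed.

(** Uniqueness of the prox point makes the iterates functions of the past: the
    levels drawn before step [t] and the states read so far. They are therefore
    constant on a history. *)
Lemma iterates_adapted t w w' :
  (forall i, (i < t)%N -> J i w = J i w') ->
  (forall i, (i <= N t w)%N -> Zt i w = Zt i w') ->
  [/\ N t w = N t w', x t w = x t w' & xf t w = xf t w'].
Proof.
elim: t => [|t IH] eJ eZ.
  have [x0 _ x0P] := mamd_init mamd.
  by rewrite !(mamd_N0 mamd) !(x0P _).1 !(x0P _).2.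
have [|i iN|eN ex exf] := IH.
- by move=> i it; rewrite eJ// ltnW.
- by apply: eZ; rewrite (mamd_N mamd) (leq_trans iN) ?leq_addr.
have eJt : J t w = J t w' by exact: eJ.
have exg : xg t w = xg t w' by rewrite !(mamd_xg mamd) ex exf.
have exS : x t.+1 w = x t.+1 w'.
  apply: xS => //; rewrite -exg -eN -eJt; apply: eq_mlmc_gradient => // i iB.
  by apply: eZ; rewrite (mamd_N mamd) leq_add2l.
by rewrite !(mamd_N mamd) eN eJt; split=> //; rewrite !(mamd_xf mamd) exS exf.
Qed.


Lemma offset_adapted t w w' :
  (forall i, (i < t)%N -> J i w = J i w') -> N t w = N t w'.
Proof.
elim: t => [|t IH] eJ; first by rewrite !(mamd_N0 mamd).
by rewrite !(mamd_N mamd) (eJ t)// IH// => i it; rewrite eJ// ltnW.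
Qed.

Section GradientError.
Hypothesis X_compact : compact X.
Hypothesis M_gt1 : (1 < M)%N.
Context {nu : probability Z R} {K : R.-pker Z ~> Z}.
Hypothesis nu_inv : invariant_law K nu.
Context {b : nat}.
Hypothesis b_gt0 : (0 < b)%N.
Hypothesis contraction : forall phi (c : R) z, 0 <= c ->
  (forall z, `|phi z| <= c) -> \int[nu]_z phi z = 0 ->
  `|transition K b phi z| <= c / 4.
Hypothesis chain : stationary_markov_chain K nu Zt.
Hypothesis indep : independent_geometric Zt J.
Context {gradf : vec -> vec} {s D2 : R}.
Hypothesis s_ge0 : 0 <= s.
Hypothesis gradF_centered :
  forall v, centered p nu s (fun y => gradF v y - gradf v).
Hypothesis V_le : forall u v, X u -> X v -> bregman omega domega u v <= D2.
Local Notation conj := (bconj X omega domega).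
Local Notation hist := (@history R dZ Z dO Om P Zt J).
Local Notation mass := (@mass R dZ Z dO Om P Zt J).

Let P1 : P setT = 1%E. Proof. exact: probability_setT. Qed.

Definition gradient_error t w : vec :=
  mlmc_gradient (gradF (xg t w)) (Zt ^~ w) (N t w) B M (J t w)
  - gradf (xg t w).

Lemma pnorm_diameter u v : X u -> X v -> pnorm p (u - v) ^+ 2 <= 2 * D2.
Proof.
move=> Xu Xv; have := bregman_ge X_convex omega_sc omega_dg Xv Xu.
have := V_le Xv Xu; lra.
Qed.

Lemma pnorm_le_diameter u v : X u -> X v -> pnorm p (u - v) <= 1 + 2 * D2.
Proof.
move=> Xu Xv; have := pnorm_diameter Xu Xv.
have := sqr_ge0 (pnorm p (u - v) - 1); rewrite sqrrB1.
have := pnorm_ge0 (p := p) (u - v); lra.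
Qed.

Lemma gradient_errorE t w : gradient_error t w =
  mlmc_gradient (fun y => gradF (xg t w) y - gradf (xg t w)) (Zt ^~ w) (N t w)
    B M (J t w).
Proof. by rewrite mlmc_gradientB. Qed.

Lemma dbound_gradient_error t w :
  dbound p (s * (1 + 2 * M%:R)) (gradient_error t w).
Proof.
rewrite gradient_errorE; apply: dbound_mlmc_gradient => // k k0.
by apply: dbound_batch_mean => //; exact: (gradF_centered _).1.
Qed.

Lemma cmap_gradient_error t : cmap (gradient_error t).
Proof.
have [_ cg] := cmap_iterates t.
apply: (cmap_comp2 (fun v v' => v - gradf v') _ cg).
apply: cmap_mlmc_gradient; [|exact: cmap_offset|exact: cmap_level].
move=> n k; apply: (cmap_comp (fun v => k%:R^-1 *: v)).
apply: cmap_sum => i; apply: cmap_comp2; first exact: cg.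
exact: cmap_chain.
Qed.

(** What step [t] adds to the right-hand side of [accelerated_regret]. *)
Definition error_cost u t w : R :=
  - gamma t * dot (gradient_error t w) (x t w - u)
  + 4^-1 * conj (x t w) ((- 4 * gamma t) *: gradient_error t w).

Lemma bounded_cmap_error_cost u t : X u -> bounded_cmap (error_cost u t).
Proof.
move=> Xu; have [cx _] := cmap_iterates t.
have {}cx : cmap (x t) by exact: (cmap_comp (@fst vec vec) cx).
have ce := cmap_gradient_error t.
apply: bounded_cmapD; apply: bounded_cmapZ.
  split; first exact: (cmap_comp2 (fun e v => dot e (v - u)) ce cx).
  exists (s * (1 + 2 * M%:R) * (1 + 2 * D2)) => w.
  apply: (le_trans (dbound_gradient_error t w _)).
  by rewrite ler_wpM2l ?mulr_ge0 ?addr_ge0 ?mulr_ge0// pnorm_le_diameter.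
split; first exact: (cmap_comp2 (fun e v => conj v ((- 4 * gamma t) *: e)) ce cx).
exists (2^-1 * (`|- 4 * gamma t| * (s * (1 + 2 * M%:R))) ^+ 2) => w.
rewrite ger0_norm; last exact: (bconj_ge0 p_ge1 X_compact).
apply: (bconj_le p_ge1 X_compact) => //; apply: dboundZ.
exact: dbound_gradient_error.
Qed.

(** On a history the iterates are constants, so the estimator becomes the
    multilevel estimator of a fixed centred field. The square of its bias is at
    most the product of the two bounds of [mean_bias_le]; [am_gm] with weight [T]
    then charges [D2 / T] to the diameter, which is summable over [T] steps, and a
    multiple of [T] times the squared bias to the noise. *)
Lemma error_cost_history_le u t n z j T w1 : X u -> 0 < gamma t -> 0 < T ->
  hist n.+1 t z j w1 -> N t w1 = n ->
  \int[P]_(w in hist n.+1 t z j) error_cost u t w <=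
  mass n.+1 t z j * (D2 / T + gamma t ^+ 2 * s ^+ 2 * (b%:R / B%:R) *
    (4 / 3 * T / M%:R + 252 * (trunc_log 2 M)%:R)).
Proof.
move=> Xu gamma0 T0 w1h N1.
have adapted w : hist n.+1 t z j w ->
    [/\ N t w = n, x t w = x t w1 & xg t w = xg t w1].
  move=> wh; have [|i iN|<- <- ef] := @iterates_adapted t w1 w.
  - by move=> i it; rewrite (wh.2 i it) (w1h.2 i it).
  - by rewrite (w1h.1 i) ?(wh.1 i)// ltnS -N1.
  have [|i iN|eN ex ef'] := @iterates_adapted t w1 w.
  - by move=> i it; rewrite (wh.2 i it) (w1h.2 i it).
  - by rewrite (w1h.1 i) ?(wh.1 i)// ltnS -N1.
  by split=> //; rewrite !(mamd_xg mamd) ex ef'.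
set G := fun y => gradF (xg t w1) y - gradf (xg t w1).
have Gc : centered p nu s G by exact: gradF_centered.
pose E w := mlmc_gradient G (Zt ^~ w) n B M (J t w).
have cE : cmap E.
  apply: (cmap_mlmc_gradient (G := fun=> G) (N := fun=> n) (j := J t)).
  - by move=> k k'; exact: cmap_batch_mean.
  - exact: cmap_cst.
  - exact: cmap_level.
have dE w : dbound p (s * (1 + 2 * M%:R)) (E w).
  apply: dbound_mlmc_gradient => // k k0.
  by apply: dbound_batch_mean => //; exact: Gc.1.
have mH := measurable_history Z_countable Z_discrete n.+1 t z j (Zt := Zt) (J := J).
pose v := x t w1 - u.
have -> : \int[P]_(w in hist n.+1 t z j) error_cost u t w =
    \int[P]_(w in hist n.+1 t z j) (- gamma t * dot (E w) v +
      4^-1 * conj (x t w1) ((- 4 * gamma t) *: E w)).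
  apply: eq_Rintegral => w /set_mem wh; have [eN ex exg] := adapted w wh.
  by rewrite /error_cost gradient_errorE eN ex exg.
have b1 : bounded_cmap (fun w => dot (E w) v).
  split; first exact: (cmap_comp (fun e => dot e v) cE).
  by exists (s * (1 + 2 * M%:R) * pnorm p v) => w; exact: dE.
have b2 : bounded_cmap (fun w => conj (x t w1) ((- 4 * gamma t) *: E w)).
  apply: (@bounded_cmap_conj _ _ _ p_ge1 _ _ _ X_compact X_convex omega_sc
    omega_dg _ _ _ _ (`|- 4 * gamma t| * (s * (1 + 2 * M%:R)))) => //.
    exact: (cmap_comp (fun e => (- 4 * gamma t) *: e) cE).
  by move=> w; apply: dboundZ.
rewrite (bounded_integral_linear P1)//; last exact: bounded_cmapZ.
rewrite RintegralZl//; last exact: (bounded_cmap_integrable P1).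
rewrite (integral_dot_mlmc Z_countable Z_discrete chain indep M_gt1 Gc).
have := conj_mlmc_le p_ge1 X_compact X_convex omega_sc omega_dg Z_countable
  Z_discrete nu_inv b_gt0 contraction chain indep B_gt0 M_gt1 s_ge0 Gc
  (- 4 * gamma t) n t z j (x_mem t w1).
rewrite -/E; set I := \int[P]_(w in _) _ => le_I.
set lvl := trunc_log 2 M in le_I *; set m := mass _ _ _ _ in le_I *.
have m0 : 0 <= m by exact: mass_ge0.
have MR : 0 < M%:R :> R by rewrite ltr0n ltnW.
have BR : 0 < B%:R :> R by rewrite ltr0n.
have bB0 : 0 <= b%:R / B%:R :> R by rewrite divr_ge0.
set beta1 := mean_bias _ _ _.
have K0 : (0 < 2 ^ lvl * B)%N by rewrite muln_gt0 expn_gt0.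
have [le1 le2] := mean_bias_le Z_countable Z_discrete nu_inv b_gt0
  contraction s_ge0 Gc (z n) v K0.
have lvlM : (2 ^+ lvl)^-1 <= 2 / M%:R :> R.
  rewrite -[X in X <= _]mul1r ler_pdivrMr ?exprn_gt0// mulrAC ler_pdivlMr// mul1r.
  by rewrite -exprS -natrX ler_nat ltnW// trunc_log_ltn.
have bias : - (gamma t * beta1) <= D2 / T + T *
    (gamma t ^+ 2 * s ^+ 2 * (4 / 3 * (b%:R / B%:R) * (2 / M%:R))) / 2.
  set q := 4 / 3 * (b%:R / B%:R) * (2 / M%:R).
  have q0 : 0 <= q by rewrite /q !mulr_ge0 ?divr_ge0 ?mulr_ge0.
  have sv0 : 0 <= s * pnorm p v by rewrite mulr_ge0 ?pnorm_ge0.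
  have {}le2 : `|beta1| <= q * (s * pnorm p v).
    apply: (le_trans le2); rewrite ler_wpM2r// natrM natrX invfM.
    have -> : 4 / 3 * b%:R * ((2 ^+ lvl)^-1 / B%:R) =
        4 / 3 * (b%:R / B%:R) * (2 ^+ lvl)^-1 :> R by ring.
    by apply: ler_wpM2l => //; rewrite mulr_ge0.
  have beta2 : beta1 ^+ 2 <= q * (s ^+ 2 * pnorm p v ^+ 2).
    rewrite -[beta1 ^+ 2]real_normK ?num_real// expr2.
    apply: (le_trans (ler_pM _ _ le1 le2)) => //.
    by rewrite le_eqVlt; apply/orP; left; apply/eqP; ring.
  have -> : D2 / T = 2 * D2 / (2 * T) by field; rewrite gt_eqF.
  have D20 : pnorm p v ^+ 2 <= 2 * D2 by apply: pnorm_diameter.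
  apply: am_gm => //.
  - by apply: le_trans D20; rewrite exprn_ge0 ?pnorm_ge0.
  - by rewrite mulr_ge0// mulr_ge0 ?sqr_ge0.
  rewrite sqrrN exprMn; apply: (le_trans (ler_wpM2l (sqr_ge0 _) beta2)).
  have c0 : 0 <= gamma t ^+ 2 * s ^+ 2 * q by rewrite mulr_ge0// mulr_ge0 ?sqr_ge0.
  have := ler_wpM2l c0 D20; lra.
have := ler_wpM2l m0 bias; lra.
Qed.

Lemma expected_error_cost_le u t T : X u -> 0 < gamma t -> 0 < T ->
  \int[P]_w error_cost u t w <=
  D2 / T + gamma t ^+ 2 * s ^+ 2 * (b%:R / B%:R) *
    (4 / 3 * T / M%:R + 252 * (trunc_log 2 M)%:R).
Proof.
move=> Xu gamma0 T0; set c := (X in _ <= X).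
have bc : bounded_cmap (error_cost u t) by exact: bounded_cmap_error_cost.
have bcst : bounded_cmap (fun _ : Om => c) by exact: bounded_cmap_cst.
have intc : \int[P]_(w in [set: Om]) c = c.
  rewrite Rintegral_cst; last exact: measurableT.
  by rewrite -[RHS]mulr1; congr (_ * _); exact: (congr1 fine P1).
rewrite -[leRHS]intc.
have -> : [set: Om] = hist 0 0 (fun=> point) (fun=> 0%N).
  by apply/seteqP; split=> // w _; split.
apply: (le_integral_level Z_countable Z_discrete (k := t)) => // j.
(* Fixing the levels fixes the offset [N t w0] at which the batch of step [t]
   starts; only then is it known how many states have to be revealed. *)
have [[w0 w0h]|none] := pselect (hist 0 t (fun=> point) j !=set0); last first.
  rewrite add0n (_ : hist 0 t _ j = set0) ?Rintegral_set0//.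
  by apply/seteqP; split=> // w wh; apply: none; exists w.
apply: (le_integral_chain Z_countable Z_discrete (k := (N t w0).+1)) => // z _.
rewrite !add0n.
have [[w1 w1h]|none] := pselect (hist (N t w0).+1 t z j !=set0); last first.
  rewrite (_ : hist _ t z j = set0) ?Rintegral_set0//.
  by apply/seteqP; split=> // w wh; apply: none; exists w.
rewrite integral_history_cst//; apply: (error_cost_history_le Xu _ _ w1h) => //.
by apply: offset_adapted => i it; rewrite (w1h.2 i it) (w0h.2 i it).
Qed.

End GradientError.
End Iterates.

(** * The expected gap *)

Theorem theorem2 (R : realType) (dZ : measure_display) (Z : measurableType dZ)
    (Z_countable : countable [set: Z])
    (Z_discrete : forall z : Z, measurable [set z])
    (pi : probability Z R) (C0 : R) (C0_gt0 : 0 < C0) :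
  exists2 C : R, 0 < C &
  forall (d : nat) (p : R) (X : set 'rV[R]_d)
    (omega : 'rV[R]_d -> \bar R) (domega : 'rV[R]_d -> 'rV[R]_d) (D : R)
    (f : 'rV[R]_d -> R) (gradf : 'rV[R]_d -> 'rV[R]_d) (fstar : R)
    (F : 'rV[R]_d -> Z -> R) (gradF : 'rV[R]_d -> Z -> 'rV[R]_d)
    (L sigma : R) (tau : nat) (K : R.-pker Z ~> Z)
    (dO : measure_display) (Om : measurableType dO) (P : probability Om R)
    (Zt : nat -> {RV P >-> Z}) (J : nat -> {RV P >-> nat})
    (gamma beta : nat -> R) (B M : nat)
    (x xg xf : nat -> Om -> 'rV[R]_d) (N : nat -> Om -> nat),
  (* geometry *)
  1 <= p <= 2 ->
  X !=set0 -> compact X -> convex_set X ->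
  proper_fun omega -> econvex omega -> lower_semicontinuous omega ->
  strongly_convex1 (pnorm p) X omega ->
  distance_gradient X omega domega ->
  is_max_on (X `*` X) (fun u => bregman omega domega u.1 u.2) (D ^+ 2) ->
  (* objective *)
  (forall u, X u -> has_mean pi (F u) (f u)) ->
  is_min_on X f fstar ->
  (* (i) *)
  has_gradient_on X f gradf -> 0 < L ->
  (forall u v, X u -> X v ->
     dual_norm (pnorm p) (gradf u - gradf v) <= L * pnorm p (u - v)) ->
  (* (ii) *)
  (forall u v, X u -> X v -> f v <= f u - dot (gradf v) (u - v)) ->
  (* (iii) *)
  stationary_markov_chain K pi Zt -> unique_invariant_law K pi ->
  (0 < tau)%N -> geometrically_ergodic K pi C0 tau ->
  (* (iv) *)
  (forall u z, is_diff u (F ^~ z) (dot (gradF u z))) ->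
  (forall u, has_vmean pi (gradF u) (gradf u)) ->
  (forall u z, dual_norm (pnorm p) (gradF u z - gradf u) ^+ 2 <= sigma ^+ 2) ->
  (* algorithm *)
  (1 <= B)%N -> (2 <= M)%N ->
  independent_geometric Zt J ->
  batched_mamd X (bregman omega domega) gradF Zt J gamma beta B M x xg xf N ->
  (forall t, 0 < gamma t) ->
  (forall t, 0 <= (beta t.+1 - 1) * gamma t.+1 <= beta t * gamma t) ->
  (forall t, 2 * gamma t * L <= beta t) ->
  beta 0%N = 1 ->
  forall T : nat, (2 <= T)%N ->
  (((beta T - 1) * gamma T)%R%:E * 'E_P[fun w => (f (xf T w) - fstar)%R]
   <= (C * (1 + ln d%:R) * ln T%:R *
       (D ^+ 2 + tau%:R * B%:R^-1 * (T%:R * M%:R^-1 + ln M%:R) * sigma ^+ 2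
                 * \sum_(0 <= t < T) gamma t ^+ 2))%R%:E)%E.
Proof.
have [c c_gt0 mixing] := mixing_blocks Z_countable Z_discrete pi C0_gt0.
have cR : 0 < c%:R :> R by rewrite ltr0n.
(* The noise of a step is at most [252 * trunc_log 2 M], and
   [trunc_log 2 M <= 2 * ln M]; the diameter is charged twice, at the start and
   through the bias; the outer factor 2 is there because [ln T >= 1/2]. *)
exists (2 * (2 + 504 * c%:R)); first by lra.
move=> d p X omega domega D f gradf fstar F gradF L sigma tau K dO Om P Zt J
  gamma beta B M x xg xf N /andP[p1 _] _ X_compact X_convex _ _ _ omega_sc
  omega_dg [_ V_le] _ [[u Xu fu] fmin] _ L0 gradf_lip f_convex chain [inv _]
  tau0 erg _ gradF_mean gradF_sigma B0 M1 indep mamd gamma0 betaS gammaL beta0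
  T T2.
have P1 : P setT = 1%E by exact: probability_setT.
pose b := (c * tau)%N; have b0 : (0 < b)%N by rewrite muln_gt0 c_gt0.
have contraction phi (m : R) z : 0 <= m -> (forall z, `|phi z| <= m) ->
    \int[pi]_z phi z = 0 -> `|transition K b phi z| <= m / 4.
  by move=> m0 phim phi0; rewrite -[X in `|X|]subr0 -phi0; exact: mixing.
have lip v v' : X v -> X v' ->
    dbound p (L * pnorm p (v - v')) (gradf v - gradf v').
  by move=> Xv Xv'; apply: dboundW (gradf_lip _ _ Xv Xv') (dual_norm_bound p1 _).
have Gc v := centered_gradient p1 Z_countable Z_discrete (gradF_mean v)
  (gradF_sigma v).
have Vle v v' : X v -> X v' -> bregman omega domega v v' <= D ^+ 2.
  by move=> Xv Xv'; exact: (V_le (v, v')).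
have beta1 t : 1 <= beta t.
  case: t => [|t]; first by rewrite beta0.
  by have /andP[+ _] := betaS t; rewrite pmulr_lge0// subr_ge0.
have [x0 Xx0 x0P] := mamd_init mamd.
have mem t w : X (x t w) /\ X (xf t w).
  move: t; apply: (mirror_iterate_mem X_convex (x := x ^~ w) (xf := xf ^~ w)
    (beta := beta)) => //.
  - by rewrite (x0P w).1.
  - by rewrite (x0P w).2.
  - by move=> t; exact: (mamd_x mamd t w).1.
  - by move=> t; exact: (mamd_xf mamd).
have x_mem t w : X (x t w) by exact: (mem t w).1.
pose cost := @error_cost R d X omega domega dZ Z dO Om P Zt J gradF gamma B M
  x xg N gradf u.
have regret w : (beta T - 1) * gamma T * (f (xf T w) - fstar) <=
    D ^+ 2 + \sum_(0 <= t < T) cost t w.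
  rewrite -fu; apply: le_trans (lerD (Vle _ _ (x_mem 0%N w) Xu) (lexx _)).
  have umin v : X v -> f u <= f v by move=> Xv; rewrite fu; exact: fmin.
  have betaS' t : (beta t.+1 - 1) * gamma t.+1 <= beta t * gamma t.
    by have /andP[] := betaS t.
  exact: (accelerated_regret p1 X_compact X_convex omega_sc omega_dg lip
    f_convex Xu umin (x_mem 0%N w) (mem 0%N w).2
    (fun t => mamd_xg mamd t w) (fun t => mamd_x mamd t w)
    (fun t => mamd_xf mamd t w) beta1 beta0 gamma0 betaS' gammaL).
have bcost t : bounded_cmap (cost t).
  exact: (bounded_cmap_error_cost p1 X_convex omega_sc omega_dg Z_countable
    Z_discrete B0 mamd x_mem X_compact (normr_ge0 sigma) Gc Vle).
have bgap : bounded_cmap (fun w => f (xf T w) - fstar).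
  have [cx _] := cmap_iterates p1 X_convex omega_sc omega_dg Z_countable
    Z_discrete mamd x_mem T.
  split; first exact: (cmap_comp (fun q => f q.2 - fstar) cx).
  have D20 : 0 <= 1 + 2 * D ^+ 2 by have := sqr_ge0 D; lra.
  have diam v v' : X v -> X v' -> pnorm p (v - v') <= 1 + 2 * D ^+ 2.
    exact: (pnorm_le_diameter X_convex omega_sc omega_dg Vle).
  pose a := L * (1 + 2 * D ^+ 2) + `|dual_norm (pnorm p) (gradf u)|.
  have a0 : 0 <= a by rewrite addr_ge0// mulr_ge0// ltW.
  exists (a * (1 + 2 * D ^+ 2)) => w; have Xw := (mem T w).2.
  have ga : dbound p a (gradf (xf T w)).
    rewrite -[gradf (xf T w)](subrK (gradf u)); apply: dboundD.
      apply: dboundW (lip _ _ Xw Xu).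
      by apply: ler_wpM2l; [exact: ltW|exact: diam].
    exact: dboundW (ler_norm _) (dual_norm_bound p1 _).
  rewrite ger0_norm ?subr_ge0 ?fmin//.
  apply: (@le_trans _ _ (a * pnorm p (u - xf T w))); last first.
    by rewrite ler_wpM2l// diam.
  have := f_convex u _ Xu Xw; have := ga (u - xf T w).
  rewrite fu ler_norml => /andP[+ _]; lra.
have intgap : P.-integrable setT (EFin \o (fun w => f (xf T w) - fstar)).
  exact: (bounded_cmap_integrable P1).
have -> : ('E_P[fun w => (f (xf T w) - fstar)%R] =
    (\int[P]_w (f (xf T w) - fstar))%R%:E)%E.
  by rewrite unlock /Rintegral fineK//; exact: integrable_fin_num.
rewrite -EFinM lee_fin -RintegralZl//.
have le1 : \int[P]_w ((beta T - 1) * gamma T * (f (xf T w) - fstar)) <=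
    D ^+ 2 + \sum_(0 <= t < T) \int[P]_w cost t w.
  have bsum : bounded_cmap (fun w => \sum_(0 <= t < T) cost t w).
    exact: bounded_cmap_sum.
  have bD : bounded_cmap (fun _ : Om => D ^+ 2) := bounded_cmap_cst _.
  apply: le_trans (bounded_integral_le P1 measurableT
    (bounded_cmapZ _ bgap) (bounded_cmapD bD bsum) (fun w _ => regret w)) _.
  rewrite RintegralD//; try exact: (bounded_cmap_integrable P1).
  rewrite (bounded_integral_sum P1)// lerD2r Rintegral_cst//.
  by rewrite -[leRHS]mulr1 le_eqVlt (congr1 fine P1) eqxx.
apply: (le_trans le1).
have TR : 0 < T%:R :> R by rewrite ltr0n ltnW.
have MR : 0 < M%:R :> R by rewrite ltr0n ltnW.
have BR : 0 < B%:R :> R by rewrite ltr0n.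
pose S := \sum_(0 <= t < T) gamma t ^+ 2.
have S0 : 0 <= S by apply: sumr_ge0 => t _; exact: sqr_ge0.
pose k := (b%:R / B%:R) * (4 / 3 * T%:R / M%:R + 252 * (trunc_log 2 M)%:R) : R.
have le2 : \sum_(0 <= t < T) \int[P]_w cost t w <=
    D ^+ 2 + S * (sigma ^+ 2 * k).
  have -> : D ^+ 2 + S * (sigma ^+ 2 * k) =
      \sum_(0 <= t < T) (D ^+ 2 / T%:R + gamma t ^+ 2 * (sigma ^+ 2 * k)).
    rewrite big_split/= sumr_const_nat subn0 -mulr_suml -/S; congr (_ + _).
    by rewrite -[_ *+ T]mulr_natl mulrC divfK// gt_eqF.
  apply: ler_sum => t _.
  have := expected_error_cost_le p1 X_convex omega_sc omega_dg Z_countable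
    Z_discrete B0 mamd x_mem X_compact M1 inv b0 contraction chain indep
    (normr_ge0 sigma) Gc Vle Xu (gamma0 t) TR.
  by rewrite real_normK ?num_real// /k !mulrA.
have lnM : (trunc_log 2 M)%:R <= 2 * ln M%:R :> R.
  by apply: trunc_log_le_ln; exact: ltnW.
pose Q := tau%:R * B%:R^-1 * (T%:R * M%:R^-1 + ln M%:R) * sigma ^+ 2 * S.
have kQ : S * (sigma ^+ 2 * k) <= 504 * c%:R * Q.
  have kle : k <= 504 * c%:R * (tau%:R * B%:R^-1 * (T%:R * M%:R^-1 + ln M%:R)).
    rewrite /k /b natrM.
    have q0 : 0 <= c%:R * tau%:R / B%:R :> R by rewrite divr_ge0 ?mulr_ge0.
    have TM0 : 0 <= T%:R / M%:R :> R by rewrite divr_ge0.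
    have : 4 / 3 * T%:R / M%:R + 252 * (trunc_log 2 M)%:R <=
      504 * (T%:R / M%:R + ln M%:R) :> R by lra.
    by move/(ler_wpM2l q0); lra.
  have Ss : 0 <= S * sigma ^+ 2 by rewrite mulr_ge0 ?sqr_ge0.
  by have := ler_wpM2l Ss kle; rewrite /Q; lra.
have Q0 : 0 <= Q.
  apply: mulr_ge0 S0; apply: mulr_ge0 (sqr_ge0 _); apply: mulr_ge0.
    exact: divr_ge0.
  by apply: addr_ge0 (ln_nat_ge0 _ _); exact: divr_ge0.
have ln_d : 1 <= 1 + ln d%:R :> R by rewrite lerDl ln_nat_ge0.
have ln_T : 2^-1 <= ln T%:R :> R.
  apply: (le_trans (ln2_ge_half R)); rewrite ler_ln ?posrE// ler_nat//.
have DQ : 0 <= D ^+ 2 + Q by rewrite addr_ge0 ?sqr_ge0.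
apply: (@le_trans _ _ ((2 + 504 * c%:R) * (D ^+ 2 + Q))).
  have := mulr_ge0 (ltW cR) (sqr_ge0 D); lra.
rewrite -/S -/Q ler_wpM2r//.
have c2 : 0 <= 2 * (2 + 504 * c%:R) :> R by lra.
have := ler_wpM2l c2 (ler_pM ler01 _ ln_d ln_T); rewrite invr_ge0 mulrA.
by move=> /(_ (ler0n _ 2)); lra.
Qed.
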